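(* Let $(\psi,c,\lambda,\underline\beta)$ and $(\psi',c',\lambda',\underline{\beta'})$ be elements of $P_{\mathfrak{sl}_n}^+\times\mathbb{C}\times(P_{\mathfrak g}^+)^\times\times\mathbb{C}^n$. If $V(\psi,c,\lambda,\underline\beta)\cong V(\psi',c',\lambda',\underline{\beta'})$ as $\widetilde\tau$-modules, then (1) $\psi=\psi'$ and $c=c'$; (2) $\lambda'\in\widehat G\lambda$, which in particular shows that $\widehat G\lambda=\widehat G\lambda'$ and $S(\lambda)=S(\lambda')$; (3) $\underline\beta-\underline{\beta'}\in\mathbb{Z}^n$.
   Context: Everything is over $\mathbb{C}$. Let $\mathfrak g$ be a finite-dimensional simple Lie algebra with Cartan subalgebra $\mathfrak h$ and a symmetric non-degenerate bilinear form $(\cdot|\cdot)$ that is invariant and preserved by every automorphism of $\mathfrak g$. Let $n\in\mathbb{N}$ and let $\sigma_1,\dots,\sigma_n$ be commuting automorphisms of $\mathfrak g$ of finite orders $m_1,\dots,m_n$. Put $\Gamma=m_1\mathbb{Z}\oplus\dots\oplus m_n\mathbb{Z}$, $G=\mathbb{Z}^n/\Gamma$, write $\underline k\mapsto\overline k$ for $\mathbb{Z}^n\to G$, fix primitive $m_i$-th roots of unity $\xi_i$, and set $\mathfrak g_{\overline k}=\{x\in\mathfrak g: \sigma_i x=\xi_i^{k_i}x,\ 1\le i\le n\}$. Let $A=\mathbb{C}[t_1^{\pm1},\dots,t_n^{\pm1}]$, $t^{\underline k}=t_1^{k_1}\cdots t_n^{k_n}$, and $LT=\bigoplus_{\underline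 k\in\mathbb{Z}^n}\mathfrak g_{\overline k}\otimes\mathbb{C}t^{\underline k}$. Standing assumption ($LT$ is a Lie torus): (1) $\mathfrak g_{\overline 0}$ is a finite-dimensional simple Lie algebra; choose a Cartan subalgebra $\mathfrak h_{\overline0}\subseteq\mathfrak h$ of it; (2) for $\overline k\ne\overline0$ with $\mathfrak g_{\overline k}\neq 0$, $\mathfrak g_{\overline k}\cong U_{\overline k}\oplus W_{\overline k}$ as $\mathfrak g_{\overline0}$-module, where $U_{\overline k}$ is trivial and $W_{\overline k}$ is either zero or irreducible of dimension $>1$ with all $\mathfrak h_{\overline0}$-weights in $\Delta_{0,\mathrm{en}}$; (3) the group generated by the $\sigma_i$ has order $\prod_i m_i$. Here $\Delta_0^\times$ is the set of non-zero roots of $(\mathfrak g_{\overline0},\mathfrak h_{\overline0})$, $\Delta_{0,\mathrm{en}}^\times=\Delta_0^\times\cup2\Delta_{0,\mathrm{sh}}^\times$ if $\Delta_0^\times$ is of type $B_l$ ($\Delta_{0,\mathrm{sh}}^\times$ = short roots), $\Delta_{0,\mathrm{en}}^\times=\Delta_0^\times$ otherwise, and $\Delta_{0,\mathrm{en}}=\Delta_{0,\mathrm{en}}^\times\cup\{0\}$. Twisted full toroidal Lie algebra: $\widetilde\tau=LT\oplus\mathcal Z(\underline m)\oplus\mathcal D(\underline m)$, where $\mathcal Z(\underline m)$ is spanned by symbols $t^{\underline r}K_i$ ($\underline r\in\Gamma$, $1\le i\le n$) modulo the relations $\sum_i r_it^{\underline r}K_i=0$, and $\mathcal D(\underline m)=\mathrm{span}\{t^{\underline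 r}d_i:\underline r\in\Gamma,1\le i\le n\}$. Brackets: $[x\otimes t^{\underline k},y\otimes t^{\underline l}]=[x,y]\otimes t^{\underline k+\underline l}+(x|y)\sum_ik_it^{\underline k+\underline l}K_i$; $\mathcal Z(\underline m)$ commutes with $LT\oplus\mathcal Z(\underline m)$; $[t^{\underline r}d_i,t^{\underline s}K_j]=s_it^{\underline r+\underline s}K_j+\delta_{ij}\sum_pr_pt^{\underline r+\underline s}K_p$; $[t^{\underline r}d_i,t^{\underline s}d_j]=s_it^{\underline r+\underline s}d_j-r_jt^{\underline r+\underline s}d_i+\phi(t^{\underline r}d_i,t^{\underline s}d_j)$; $[t^{\underline r}d_i,x\otimes t^{\underline k}]=k_i\,x\otimes t^{\underline k+\underline r}$. Here $\phi$ is a fixed linear combination of the cocycles $\phi_1(t^{\underline r}d_i,t^{\underline s}d_j)=-s_ir_j\sum_pr_pt^{\underline r+\underline s}K_p$ and $\phi_2(t^{\underline r}d_i,t^{\underline s}d_j)=r_is_j\sum_pr_pt^{\underline r+\underline s}K_p$. Parameters: $P^+_{\mathfrak{s}}$ denotes the dominant integral weights of $\mathfrak s$; $(P_{\mathfrak g}^+)^\times=P_{\mathfrak g}^+\setminus\{0\}$. $V(c,\psi)$ is the finite-dimensional irreducible $\mathfrak{gl}_n(\mathbb{C})$-module with $\mathfrak{sl}_n$-highest weight $\psi$ on which the identity matrix acts by $c$. $V(\lambda)$ is the irreducible $\mathfrak g$-module of highest weight $\lambda$. $\widehat G=\mathrm{Hom}(G,\mathbb{C}^\times)$ acts on $\mathfrak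 g$ by automorphisms $\alpha_\chi(x)=\chi(\overline k)x$ ($x\in\mathfrak g_{\overline k}$), hence by twisting on isomorphism classes of finite-dimensional irreducible $\mathfrak g$-modules, hence on $P_{\mathfrak g}^+$; $\widehat G\lambda=\{\lambda_1,\dots,\lambda_l\}$ is the orbit. A $G$-graded $\mathfrak g$-module (with $\mathfrak g_{\overline k}M_{\overline l}\subseteq M_{\overline k+\overline l}$) is $G$-graded-irreducible if it has no proper non-zero graded submodule. The graded Schur index $S(\lambda)\in\mathbb{N}$ is the unique positive integer for which $\bigoplus_{i=1}^lV(\lambda_i)^{\oplus S(\lambda)}$ carries a $G$-grading making it a $G$-graded-irreducible $\mathfrak g$-module. The module $V(\psi,c,\lambda,\underline\beta)$: let $V_1=V(c,\psi)$ and let $V_2=\bigoplus_{\overline k\in G}V_{2,\overline k}$ be $\bigoplus_{i=1}^lV(\lambda_i)^{\oplus S(\lambda)}$ with a $G$-grading making it $G$-graded-irreducible. Then $V(\psi,c,\lambda,\underline\beta)=\bigoplus_{\underline k\in\mathbb{Z}^n}V_1\otimes V_{2,\overline k}\otimes\mathbb{C}t^{\underline k}\subseteq V_1\otimes V_2\otimes A$ with action $(x\otimes t^{\underline l})(v_1\otimes v_2\otimes t^{\underline k})=v_1\otimes xv_2\otimes t^{\underline k+\underline l}$ for $x\in\mathfrak g_{\overline l}$; $t^{\underline r}d_i(v_1\otimes v_2\otimes t^{\underline k})=(k_i+\beta_i)v_1\otimes v_2\otimes t^{\underline k+\underline r}+\sum_{j}(r_jm_jE_{ji}v_1)\otimes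 v_2\otimes t^{\underline k+\underline r}$ for $\underline r=(r_1m_1,\dots,r_nm_n)\in\Gamma$ ($E_{ij}$ the matrix units); and $t^{\underline r}K_i$ acts by $0$. *)

(* Defs.v *)
From HB Require Import structures.
From mathcomp Require Import all_boot all_order all_algebra.
From mathcomp Require Import boolp classical_sets functions cardinality fsbigop.
From mathcomp Require Import reals complex.
Set Implicit Arguments.
Unset Strict Implicit.
Unset Printing Implicit Defensive.
Import Order.TTheory GRing.Theory Num.Theory.
Local Open Scope ring_scope.

Section LieAlgebra.
Variable F : numClosedFieldType.

Definition lie_algebra (L : lmodType F) (br : L -> L -> L) :=
  [/\ forall x, linear (br x), forall y, linear (br^~ y), forall x, br x x = 0
    & forall x y z, br x (br y z) + br y (br z x) + br z (br x y) = 0].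

Definition lie_module (L : lmodType F) (br : L -> L -> L)
    (V : lmodType F) (act : L -> V -> V) :=
  [/\ forall x, linear (act x), forall v, linear (act^~ v)
    & forall x y v, act (br x y) v = act x (act y v) - act y (act x v)].

Definition isomorphic_modules (L : lmodType F) (br : L -> L -> L)
    (V V' : lmodType F) (act : L -> V -> V) (act' : L -> V' -> V') :=
  [/\ lie_module br act, lie_module br act'
    & exists f : {linear V -> V'}, bijective f /\
        forall x v, f (act x v) = act' x (f v)].

Section Subspaces.
Variables (g V : vectType F) (br : g -> g -> g) (act : g -> V -> V).

Definition stable (S : {vspace g}) (U : {vspace V}) :=
  forall x v, x \in S -> v \in U -> act x v \in U.

Definition irreducible (S : {vspace g}) (U : {vspace V}) :=
  [/\ U != 0%VS, stable S U
    & forall U', (U' <= U)%VS -> stable S U' -> U' = 0%VS \/ U' = U].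

End Subspaces.

Variables (g : vectType F) (br : g -> g -> g).

Definition simple_lie (S : {vspace g}) :=
  [/\ stable br S S, exists x y, [/\ x \in S, y \in S & br x y != 0]
    & forall I, (I <= S)%VS -> stable br S I -> I = 0%VS \/ I = S].

Definition lie_prod (U W : {vspace g}) : {vspace g} :=
  <<[seq br x y | x <- vbasis U, y <- vbasis W]>>%VS.

Definition nilpotent (H : {vspace g}) := exists k, iter k (lie_prod H) H = 0%VS.

Definition cartan_subalgebra (S H : {vspace g}) :=
  [/\ (H <= S)%VS, stable br H H, nilpotent H
    & forall x, x \in S -> (forall y, y \in H -> br x y \in H) -> x \in H].

Definition automorphism (f : 'End(g)) :=
  bijective f /\ {morph f : x y / br x y}.

Definition invariant_form (form : g -> g -> F) :=
  [/\ forall x a y z, form x (a *: y + z) = a * form x y + form x z,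
      forall x y, form x y = form y x,
      forall x, (forall y, form x y = 0) -> x = 0,
      forall x y z, form (br x y) z = form x (br y z)
    & forall f, automorphism f -> forall x y, form (f x) (f y) = form x y].

Definition dual (h : {vspace g}) := 'Hom(subvs_of h, F^o).

Definition weight_vector (V : vectType F) (act : g -> V -> V) (h : {vspace g})
    (mu : dual h) (v : V) :=
  forall y : subvs_of h, act (vsval y) v = (mu y : F) *: v.

Section Roots.
Variables S h : {vspace g}.

Definition root (alpha : dual h) :=
  alpha != 0 /\ exists2 x, x \in S & x != 0 /\ weight_vector br alpha x.

Definition nonneg_comb (Pi : seq (dual h)) (alpha : dual h) :=
  exists c : 'I_(size Pi) -> nat, alpha = \sum_(i < size Pi) Pi`_i *+ c i.

Definition simple_roots (Pi : seq (dual h)) :=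
  [/\ basis_of fullv Pi, forall alpha, alpha \in Pi -> root alpha
    & forall alpha, root alpha ->
        nonneg_comb Pi alpha \/ nonneg_comb Pi (- alpha)].

Definition coroot (alpha : dual h) (y : subvs_of h) :=
  (alpha y : F) = 2 /\ exists e f, [/\ e \in S, f \in S, weight_vector br alpha e,
    weight_vector br (- alpha) f & vsval y = br e f].

Definition dominant_integral (Pi : seq (dual h)) (lambda : dual h) :=
  forall alpha y, alpha \in Pi -> coroot alpha y ->
    exists k : nat, (lambda y : F) = k%:R.

Definition killing (x y : g) : F :=
  \sum_(i < \dim S) coord (vbasis S) i (br x (br y (vbasis S)`_i)).

Definition killing_dual (alpha : dual h) (t : subvs_of h) :=
  forall y : subvs_of h, killing (vsval t) (vsval y) = alpha y.

Definition short_root (alpha : dual h) :=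
  root alpha /\ forall beta ta tb, root beta ->
    killing_dual alpha ta -> killing_dual beta tb ->
    killing (vsval ta) (vsval ta) <= killing (vsval tb) (vsval tb).

(* B_1 = A_1 counts as type B, as usual for Lie tori; all its roots are short. *)
Definition type_B :=
  exists l (e : 'I_l -> dual h), basis_of fullv (codom e) /\
    forall alpha, root alpha <->
      (exists i (b : bool), alpha = (-1) ^+ b *: e i) \/
      (exists (i j : 'I_l) (b b' : bool), (i < j)%N /\
         alpha = (-1) ^+ b *: e i + (-1) ^+ b' *: e j).

(* Delta_{0,en}, with 0 included *)
Definition enlarged_root (alpha : dual h) :=
  [\/ alpha = 0, root alpha
    | type_B /\ exists2 beta, short_root beta & alpha = 2 *: beta].

End Roots.

(* U is a copy of V(lambda) inside a g-module: an irreducible submodule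
   generated by a highest weight vector of weight lambda. *)
Definition is_irr_hw (h : {vspace g}) (Pi : seq (dual h)) (lambda : dual h)
    (V : vectType F) (act : g -> V -> V) (U : {vspace V}) :=
  irreducible act fullv U /\
  exists v, [/\ v \in U, v != 0, weight_vector act lambda v
    & forall alpha x, root fullv alpha -> nonneg_comb Pi alpha ->
        weight_vector br alpha x -> act x v = 0].

End LieAlgebra.

Section GeneralLinear.
Variables (F : numClosedFieldType) (n : nat).

Definition gl_br (A B : 'M[F]_n) : 'M[F]_n := A *m B - B *m A.

Definition sl_cartan : {vspace 'M[F]_n} :=
  <<[seq delta_mx i i - delta_mx j j | i <- enum 'I_n, j <- enum 'I_n]>>%VS.

Definition sl_dominant_integral (psi : dual sl_cartan) :=
  forall (i j : 'I_n) (y : subvs_of sl_cartan), j = i.+1 :> nat ->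
    vsval y = delta_mx i i - delta_mx j j ->
    exists k : nat, (psi y : F) = k%:R.

Definition is_V_gl (c : F) (psi : dual sl_cartan)
    (V : vectType F) (act : 'M[F]_n -> V -> V) :=
  [/\ lie_module gl_br act, irreducible act fullv fullv,
      forall v, act 1%:M v = c *: v
    & exists v, [/\ v != 0, weight_vector act psi v
        & forall i j : 'I_n, (i < j)%N -> act (delta_mx i j) v = 0]].

End GeneralLinear.

Section TensorProduct.
Variables (F : fieldType) (V1 V2 : vectType F).

(* V1 (x) V2 in coordinates with respect to the bases vbasis. *)
Definition tens : vectType F := 'M[F]_(\dim {:V1}, \dim {:V2}).

Definition pure (v1 : V1) (v2 : V2) : tens :=
  \matrix_(i, j) (coord (vbasis {:V1}) i v1 * coord (vbasis {:V2}) j v2).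

Definition tens_sub (U1 : {vspace V1}) (U2 : {vspace V2}) : {vspace tens} :=
  <<[seq pure v1 v2 | v1 <- vbasis U1, v2 <- vbasis U2]>>%VS.

(* linear extension of v1 (x) v2 |-> f1 v1 (x) f2 v2 *)
Definition tens_map (f1 : V1 -> V1) (f2 : V2 -> V2) (w : tens) : tens :=
  \sum_i \sum_j w i j *:
    pure (f1 (vbasis {:V1})`_i) (f2 (vbasis {:V2})`_j).

End TensorProduct.

Section GradedSum.
Variables (F : fieldType) (n : nat) (W : vectType F).
Variable U : 'rV[int]_n -> {vspace W}.

Local Notation Zn := 'rV[int]_n.

(* The direct sum of the U k (x) C t^k, as finitely supported families. *)
Definition gsum_pred : {pred Zn -> W} := fun f =>
  `[< finite_set [set k | f k != 0] /\ forall k, f k \in U k >].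

Lemma gsum_submod : submod_closed gsum_pred.
Proof.
split=> [|a f f' /asboolP[ff fU] /asboolP[f'f f'U]]; apply/asboolP; split.
- by apply: (sub_finite_set _ (finite_set0 _)) => k /=; rewrite eqxx.
- by move=> k; exact: mem0v.
- apply: (@sub_finite_set _ _ ([set k | f k != 0] `|` [set k | f' k != 0])%classic).
    move=> k /=; case: (eqVneq (f k) 0) => [fk0|]; last by left.
    move=> fk; right; move: fk; rewrite [X in X != 0](_ : _ = a *: f k + f' k)//.
    by rewrite fk0 scaler0 add0r.
  by rewrite finite_setU.
- move=> k; rewrite [X in X \in _](_ : _ = a *: f k + f' k)//.
  by rewrite memvD ?memvZ.
Qed.

HB.instance Definition _ := GRing.isSubmodClosed.Build F (Zn -> W) gsum_pred gsum_submod.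

Record gsum := GSum { gsum_val :> Zn -> W; _ : gsum_val \in gsum_pred }.

HB.instance Definition _ := [isSub for gsum_val].
HB.instance Definition _ := [Choice of gsum by <:].
HB.instance Definition _ := [SubChoice_isSubLmodule of gsum by <:].

(* w (x) t^k; only used when w \in U k *)
Definition mono (k : Zn) (w : W) : gsum :=
  insubd 0 (fun j => if j == k then w else 0).

End GradedSum.

(* The bilinear map sending (w (x) t^k, v (x) t^l) to b k w l v (x) t^(k+l). *)
Definition conv (F : fieldType) n (W1 W2 W3 : vectType F)
    (U1 : 'rV[int]_n -> {vspace W1}) (U2 : 'rV[int]_n -> {vspace W2})
    (U3 : 'rV[int]_n -> {vspace W3})
    (b : 'rV[int]_n -> W1 -> 'rV[int]_n -> W2 -> W3)
    (x : gsum U1) (y : gsum U2) : gsum U3 :=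
  \sum_(k \in [set: 'rV[int]_n]) \sum_(l \in [set: 'rV[int]_n])
    mono U3 (k + l) (b k (x k) l (y l)).
Arguments conv {F n W1 W2 W3 U1 U2} U3 b x y.

Section Grading.
Variables (F : numClosedFieldType) (n : nat) (m : 'I_n -> nat).

(* Gamma = m_1 Z + ... + m_n Z *)
Definition Gamma : {pred 'rV[int]_n} :=
  fun k => [forall i, ((m i)%:Z %| (k 0%R i))%Z].

Lemma Gamma_zmod : zmod_closed Gamma.
Proof.
split=> [|k l /forallP kG /forallP lG]; apply/forallP => i.
  by rewrite mxE dvdz0.
by rewrite !mxE rpredB.
Qed.

HB.instance Definition _ := GRing.isZmodClosed.Build _ Gamma Gamma_zmod.

(* G = Z^n / Gamma *)
Definition grG := Quotient.quot Gamma.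
HB.instance Definition _ := GRing.Zmodule.on grG.

Definition bar (k : 'rV[int]_n) : grG := (\pi_(Quotient.quot Gamma) k)%qT.

Definition is_character (chi : grG -> F) :=
  chi 0 = 1 /\ forall a b, chi (a + b) = chi a * chi b.

Definition is_grading (V : vectType F) (gr : grG -> {vspace V}) :=
  (exists s : seq grG, (\sum_(a <- s) gr a)%VS = fullv) /\
  forall s : seq grG, uniq s -> directv (\sum_(a <- s) gr a).

Definition graded_subspace (V : vectType F) (gr : grG -> {vspace V})
    (U : {vspace V}) :=
  exists s : seq grG, (\sum_(a <- s) (U :&: gr a))%VS = U.

End Grading.

Section Torus.
Variables (F : numClosedFieldType) (g : vectType F) (br : g -> g -> g).
Variables (form : g -> g -> F) (h : {vspace g}) (Pi : seq (dual h)).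
Variables (n : nat) (sigma : 'I_n -> 'End(g)) (m : 'I_n -> nat) (xi : 'I_n -> F).

Local Notation Zn := 'rV[int]_n.
Local Notation G := (grG m).

Definition has_order (f : 'End(g)) (d : nat) :=
  [/\ (0 < d)%N, forall x, iter d f x = x
    & forall j, (0 < j < d)%N -> exists x, iter j f x != x].

Definition commuting_automorphisms :=
  [/\ forall i, automorphism br (sigma i),
      forall i j x, sigma i (sigma j x) = sigma j (sigma i x)
    & forall i, has_order (sigma i) (m i)].

Definition generated_group : set 'End(g) :=
  [set f | forall P : set 'End(g), P \1%VF ->
     (forall i f', P f' -> P (sigma i \o f')%VF) ->
     (forall i f', P f' -> P ((sigma i)^-1 \o f')%VF) -> P f].

(* g_(bar k); it depends on the class of k modulo Gamma only *)
Definition eig (k : Zn) : {vspace g} :=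
  (\bigcap_(i < n) lker (sigma i - (xi i ^ k 0 i)%R *: \1%VF)%R)%VS.

Definition lie_torus (h0 : {vspace g}) :=
  [/\ simple_lie br (eig 0),
      cartan_subalgebra br (eig 0) h0,
      forall k, k \notin Gamma m -> eig k != 0%VS ->
        exists U W : {vspace g},
        [/\ (U + W)%VS = eig k, directv (U + W),
            forall x u, x \in eig 0 -> u \in U -> br x u = 0
          & W = 0%VS \/
            [/\ irreducible br (eig 0) W, (1 < \dim W)%N
              & forall mu w, w \in W -> w != 0 -> weight_vector br mu w ->
                  enlarged_root br (eig 0) (mu : dual h0)]]
    & (generated_group #= `I_(\prod_(i < n) m i))%card].

Section FullToroidal.
Variables a1 a2 : F.

Definition zc (k : Zn) (i : 'I_n) : F := (k 0 i)%:~R.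

(* as a coefficient of t^k in KK: sum_i k_i t^k K_i *)
Definition zvec (k : Zn) : 'rV[F]_n := \row_i zc k i.

Definition GammaU (r : Zn) : {vspace 'rV[F]_n} :=
  if r \in Gamma m then fullv else 0%VS.

Definition LT := gsum eig.
HB.instance Definition _ := GRing.Lmodule.on LT.

(* The coefficient u of t^r stands for sum_i u_i t^r d_i. *)
Definition DD := gsum GammaU.
HB.instance Definition _ := GRing.Lmodule.on DD.

(* Z(m) is the quotient of the span KK of the symbols t^r K_i by Zrel, the span
   of the elements sum_i r_i t^r K_i. *)
Definition KK := gsum GammaU.
HB.instance Definition _ := GRing.Lmodule.on KK.

Definition Zrel : {pred KK} := fun z => `[< forall r, z r \in <[zvec r]>%VS >].

Lemma Zrel_submod : submod_closed Zrel.
Proof.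
split=> [|a z z' /asboolP zr /asboolP z'r]; apply/asboolP => r.
  exact: mem0v.
rewrite [X in X \in _](_ : _ = a *: z r + z' r)//.
by rewrite memvD ?memvZ.
Qed.

HB.instance Definition _ := GRing.isSubmodClosed.Build F KK Zrel Zrel_submod.

Definition ZZ := Quotient.quot Zrel.
HB.instance Definition _ := GRing.Zmodule.on ZZ.

Definition piZ (z : KK) : ZZ := (\pi_(Quotient.quot Zrel) z)%qT.

Let scaleZ (a : F) (z : ZZ) : ZZ := piZ (a *: repr z).

Let reprZK (z : ZZ) : piZ (repr z) = z. Proof. exact: reprK. Qed.

Let piZD : {morph piZ : x y / x + y}. Proof. exact: raddfD. Qed.

Let piZZ a x : scaleZ a (piZ x) = piZ (a *: x).
Proof.
apply/eqP; rewrite -Quotient.idealrBE -scalerBr rpredZ//.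
by rewrite Quotient.idealrBE reprK.
Qed.

Let scaleZA a b x : scaleZ a (scaleZ b x) = scaleZ (a * b) x.
Proof. by rewrite -[x]reprZK !piZZ scalerA. Qed.

Let scaleZ1 : left_id 1 scaleZ.
Proof. by move=> x; rewrite -[x]reprZK piZZ scale1r. Qed.

Let scaleZDr : right_distributive scaleZ +%R.
Proof.
by move=> a x y; rewrite -[x]reprZK -[y]reprZK -piZD !piZZ scalerDr piZD.
Qed.

Let scaleZDl x : {morph scaleZ^~ x : a b / a + b}.
Proof. by move=> a b; rewrite -[x]reprZK !piZZ scalerDl piZD. Qed.

HB.instance Definition _ :=
  GRing.Zmodule_isLmodule.Build F ZZ scaleZA scaleZ1 scaleZDr scaleZDl.

Definition tau : lmodType F := (LT * ZZ * DD)%type.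

Local Notation e_ i := (delta_mx 0 i : 'rV[F]_n).

Definition brLL (k : Zn) (x : g) (l : Zn) (y : g) : g := br x y.

Definition brLLK (k : Zn) (x : g) (l : Zn) (y : g) : 'rV[F]_n :=
  form x y *: zvec k.

Definition brDL (r : Zn) (u : 'rV[F]_n) (k : Zn) (x : g) : g :=
  \sum_i (u 0 i * zc k i) *: x.

Definition brDK (r : Zn) (u : 'rV[F]_n) (s : Zn) (w : 'rV[F]_n) : 'rV[F]_n :=
  \sum_i \sum_j (u 0 i * w 0 j) *:
    (zc s i *: e_ j + (i == j)%:R *: zvec r).

Definition brDD (r : Zn) (u : 'rV[F]_n) (s : Zn) (v : 'rV[F]_n) : 'rV[F]_n :=
  \sum_i \sum_j (u 0 i * v 0 j) *: (zc s i *: e_ j - zc r j *: e_ i).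

(* phi = a1 phi_1 + a2 phi_2 *)
Definition phi (r : Zn) (u : 'rV[F]_n) (s : Zn) (v : 'rV[F]_n) : 'rV[F]_n :=
  \sum_i \sum_j (u 0 i * v 0 j) *:
    (a1 *: - ((zc s i * zc r j) *: zvec r)
     + a2 *: ((zc r i * zc s j) *: zvec r)).

Definition tau_br (X Y : tau) : tau :=
  let: (x, z, d) := X in let: (y, w, e) := Y in
  ((conv eig brLL x y + conv eig brDL d y - conv eig brDL e x : LT,
    piZ (conv GammaU brLLK x y + conv GammaU brDK d (repr w)
         - conv GammaU brDK e (repr z) + conv GammaU phi d e)),
   conv GammaU brDD d e : DD).

End FullToroidal.

(* mu is in the orbit of lambda under the dual group of G. *)
Definition char_orbit (lambda : dual h) : set (dual h) :=
  [set mu | exists (chi : G -> F) (alpha : 'End(g)) (V : vectType F)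
      (act : g -> V -> V),
    [/\ is_character chi, forall k x, x \in eig k -> alpha x = chi (bar m k) *: x,
        lie_module br act, is_irr_hw br Pi lambda act fullv
      & is_irr_hw br Pi mu (fun x => act (alpha x)) fullv]].

Section GradedModule.
Variables (V : vectType F) (act : g -> V -> V) (gr : G -> {vspace V}).

Definition graded_module :=
  [/\ lie_module br act, is_grading gr
    & forall k l x v, x \in eig k -> v \in gr (bar m l) ->
        act x v \in gr (bar m k + bar m l)].

Definition graded_irreducible :=
  [/\ graded_module, fullv != 0%VS :> {vspace V}
    & forall U, stable act fullv U -> graded_subspace gr U ->
        U = 0%VS \/ U = fullv].

(* V is the direct sum, over mu in the orbit of lambda, of S copies of V(mu). *)
Definition orbit_sum (lambda : dual h) (S : nat) :=
  exists (s : seq (dual h)) (U : 'I_(size s) * 'I_S -> {vspace V}),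
  [/\ uniq s, forall mu, char_orbit lambda mu <-> mu \in s,
      forall (i : 'I_(size s)) j, is_irr_hw br Pi s`_i act (U (i, j)),
      (\sum_p U p)%VS = fullv & directv (\sum_p U p)].

End GradedModule.

Definition schur_index (lambda : dual h) : nat :=
  xget 0%N [set S | (0 < S)%N /\ exists (V : vectType F) (act : g -> V -> V)
    (gr : G -> {vspace V}), orbit_sum act lambda S /\ graded_irreducible act gr].

Definition is_V2 (lambda : dual h) (V2 : vectType F) (act2 : g -> V2 -> V2)
    (gr : G -> {vspace V2}) :=
  orbit_sum act2 lambda (schur_index lambda) /\ graded_irreducible act2 gr.

Section Modules.
Variables (V1 V2 : vectType F) (act1 : 'M[F]_n -> V1 -> V1) (act2 : g -> V2 -> V2).
Variables (gr : G -> {vspace V2}) (beta : 'rV[F]_n).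

Definition Vmod := gsum (fun k => tens_sub {:V1} (gr (bar m k))).
HB.instance Definition _ := GRing.Lmodule.on Vmod.

Definition actL (l : Zn) (x : g) (k : Zn) (w : tens V1 V2) : tens V1 V2 :=
  tens_map id (act2 x) w.

(* For r in Gamma the entry r_j here is the integer r_j m_j of the formula
   written with r = (r_1 m_1, ..., r_n m_n). *)
Definition actD (r : Zn) (u : 'rV[F]_n) (k : Zn) (w : tens V1 V2) : tens V1 V2 :=
  \sum_i u 0 i *: ((zc k i + beta 0 i) *: w +
    \sum_j zc r j *: tens_map (act1 (delta_mx j i)) id w).

Definition Vact (X : tau) (f : Vmod) : Vmod :=
  let: (x, z, d) := X in conv _ actL x f + conv _ actD d f.

End Modules.

End Torus.

(* Main.v *)
(* The derivations t^0 d_i act on the part of degree k of V(psi, c, lambda, beta) by k_i + beta_i, so an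
   isomorphism f shifts degrees by a fixed s in Z^n with s = beta - beta'.  As lambda is non-zero, V2 is spanned
   by the elements x v with x in g; writing an element of degree k + r (r in Gamma) as a sum of
   (x t^(l + r)) (v1 (x) v t^(k - l)) shows that the component of f in degree k depends only on the class of k
   modulo Gamma.  Comparing with the action of t^r d_i, these components commute with gl_n, and they glue to a
   map V1 (x) V2 -> V1' (x) V2' commuting with gl_n and g.  Fixing a vector of one tensor factor and a coordinate
   of the image gives non-zero homomorphisms V1 -> V1' and V2 -> V2'.  The first one compares highest weights and
   central characters; the second one identifies an irreducible summand of V2 with one of V2', and uniqueness of
   the irreducible module of a given highest weight puts lambda and lambda' in the same orbit.

   That uniqueness requires the root space decomposition of g.  Here the simple roots span the dual of h, so h is
   abelian, and being self-normalising it is its own generalised weight space of weight 0.  The invariant form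
   pairs generalised weight spaces of opposite weights, and an sl_2 argument with a root vector a of weight alpha
   shows that no non-zero element of generalised weight - alpha is orthogonal to a, so that this space consists of
   genuine weight vectors. *)
From HB Require Import structures.
Require Import Defs.
From mathcomp Require Import all_boot all_order all_algebra.
From mathcomp Require Import reals complex.
From mathcomp Require Import finmap.
From mathcomp Require Import boolp classical_sets cardinality fsbigop.
From mathcomp Require Import ring.
Set Implicit Arguments.
Unset Strict Implicit.
Unset Printing Implicit Defensive.
Import Order.TTheory GRing.Theory Num.Theory.
Local Open Scope ring_scope.

(** * Generalised weight decomposition for commuting operators *)

Section LinearAlgebra.
Variable F : numClosedFieldType.

Lemma linear_lfunE (U W : vectType F) (f : U -> W) : linear f ->
  forall u, linfun f u = f u.
Proof.
move=> fL; pose f' := HB.pack_for {linear U -> W} f (GRing.isLinear.Build _ _ _ _ f fL).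
by move=> u; rewrite -[RHS]/(f' u) -[in RHS]lfunE.
Qed.

Lemma shift_lfunE (V : vectType F) (T : 'End(V)) c v :
  (T - c *: \1%VF)%R v = T v - c *: v.
Proof. by rewrite add_lfunE opp_lfunE scale_lfunE id_lfunE. Qed.

(** Among the subspaces contained in [P] take one of largest dimension: together with a vector of
    [P] outside it, it would span a larger one. This turns arguments by linearity into inclusions of
    subspaces. *)
Lemma exists_vspace (V : vectType F) (P : V -> Prop) :
  P 0 -> (forall a u v, P u -> P v -> P (a *: u + v)) ->
  exists U : {vspace V}, forall u, u \in U <-> P u.
Proof.
move=> P0 PD.
pose Q d := `[< exists2 U : {vspace V}, \dim U = d & forall u, u \in U -> P u >].
have exQ : exists d, Q d.
  exists 0%N; apply/asboolP; exists 0%VS; first by rewrite dimv0.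
  by move=> u; rewrite memv0 => /eqP ->.
have Qb d : Q d -> (d <= \dim {:V})%N.
  by move=> /asboolP[U <- _]; exact: dimvS (subvf _).
case: (ex_maxnP exQ Qb) => d /asboolP[U dU PU] dmax.
exists U => u; split; first exact: PU.
move=> Pu; apply: contrapT => /negP uU.
have /dmax : Q (\dim (U + <[u]>)).
  apply/asboolP; exists (U + <[u]>)%VS => // w /memv_addP[w1 w1U [w2 /vlineP[a ->] ->]].
  by rewrite addrC; apply: PD => //; exact: PU.
rewrite -dU leqNgt (ltn_leqif (dimv_leqif_sup (addvSl _ _))) negbK.
by move/negP: uU => uU /subvP sU; apply: uU; apply: sU; rewrite memvE addvSr.
Qed.

(** The characteristic polynomial of the matrix of [T] on [W] has a root. Row [i] of the matrix
    holds the coordinates of the image of the i-th basis vector, so its row eigenvectors are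
    coordinate vectors of eigenvectors of [T]. *)
Lemma eigenvector_in (V : vectType F) (T : 'End(V)) (W : {vspace V}) :
  W != 0%VS -> (forall w, w \in W -> T w \in W) ->
  exists c w, [/\ w \in W, w != 0 & T w = c *: w].
Proof.
move=> W0 TW; set b := vbasis W.
have bW (i : 'I_(\dim W)) : b`_i \in W by rewrite vbasis_mem// mem_nth ?size_tuple.
case dW: (\dim W) => [|d]; first by rewrite -dimv_eq0 dW in W0.
pose A := \matrix_(i < \dim W, j < \dim W) coord b j (T b`_i).
have [c] : exists c, root (char_poly A) c.
  by apply: closed_rootP; rewrite size_char_poly dW.
rewrite -eigenvalue_root_char => /eigenvalueP[v vA v0].
exists c, (\sum_i v 0 i *: b`_i); split.
- by apply: memv_suml => i _; apply: memvZ.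
- apply: contra v0 => /eqP v0; apply/eqP/rowP => i; rewrite mxE.
  by move/freeP: (basis_free (vbasisP W)) => /(_ (v 0) v0 i).
- rewrite linear_sum scaler_sumr.
  under eq_bigr => i _ do rewrite linearZ /= [T _](coord_vbasis (TW _ (bW i))) scaler_sumr.
  rewrite exchange_big; apply: eq_bigr => j _; rewrite scalerA.
  move/rowP/(_ j): vA; rewrite !mxE => <-; rewrite scaler_suml.
  by apply: eq_bigr => i _; rewrite scalerA mxE.
Qed.

(** The list consists of the roots of the characteristic polynomial. Below it bounds the length of
    strings of weights. *)
Lemma finite_spectrum (V : vectType F) (T : 'End(V)) : exists s : seq F,
  forall c w, w != 0 -> T w = c *: w -> c \in s.
Proof.
set b := vbasis {:V}.
pose A := \matrix_(i < \dim {:V}, j < \dim {:V}) coord b j (T b`_i).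
have [s sP] := closed_field_poly_normal (char_poly A).
exists s => c w w0 Tw.
have: root (char_poly A) c.
  rewrite -eigenvalue_root_char; apply/eigenvalueP; exists (\row_i coord b i w).
    apply/rowP => j; rewrite !mxE -[RHS]linearZ -Tw /= [in RHS](coord_vbasis (memvf w)).
    rewrite !linear_sum; apply: eq_bigr => i _ /=.
    by rewrite !linearZ !mxE.
  apply: contra w0 => /eqP w0; rewrite (coord_vbasis (memvf w)) big1// => i _.
  by move/rowP/(_ i): w0; rewrite !mxE => ->; rewrite scale0r.
by rewrite sP rootZ ?root_prod_XsubC// lead_coef_eq0 monic_neq0 ?char_poly_monic.
Qed.

Lemma exists_iter_lfun (V : vectType F) (T : 'End(V)) p :
  exists Tp : 'End(V), forall v, Tp v = iter p T v.
Proof.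
elim: p => [|p [Tp TpE]]; first by exists \1%VF => v; rewrite lfunE.
by exists (T \o Tp)%VF => v; rewrite lfunE /= TpE.
Qed.

Lemma iter_stable (V : vectType F) (T : V -> V) (W : {vspace V}) p w :
  (forall w, w \in W -> T w \in W) -> w \in W -> iter p T w \in W.
Proof. by move=> TW wW; elim: p => //= p; exact: TW. Qed.

(** Choose a power of [T] whose kernel has the largest dimension: its square has the same kernel, so
    kernel and image meet in 0 only, and a dimension count gives the sum. The exponent [p.+1] is
    positive, so that the kernel of [T] lies in that of [Tp]. *)
Lemma fitting (V : vectType F) (T : 'End(V)) (W : {vspace V}) :
  (forall w, w \in W -> T w \in W) ->
  exists (p : nat) (Tp : 'End(V)), [/\ forall v, Tp v = iter p.+1 T v,
    W = ((W :&: lker Tp) + Tp @: W)%VS & ((W :&: lker Tp) :&: Tp @: W = 0)%VS].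
Proof.
move=> TW.
pose Q d := `[< exists p (Tp : 'End(V)), (forall v, Tp v = iter p.+1 T v) /\ \dim (lker Tp) = d >].
have exQ : exists d, Q d.
  by exists (\dim (lker T)); apply/asboolP; exists 0%N, T.
have Qb d : Q d -> (d <= \dim {:V})%N.
  by move=> /asboolP[p [Tp [_ <-]]]; exact: dimvS (subvf _).
case: (ex_maxnP exQ Qb) => d /asboolP[p [Tp [TpE dTp]]] dmax.
exists p, Tp.
have kTp v : Tp (Tp v) = 0 -> Tp v = 0.
  have /dmax : Q (\dim (lker (Tp \o Tp))).
    apply/asboolP; exists (p + p.+1)%N, (Tp \o Tp)%VF; split=> // u.
    by rewrite lfunE /= !TpE -iterD addSn.
  have s : (lker Tp <= lker (Tp \o Tp))%VS.
    by apply/subvP => u; rewrite !memv_ker lfunE /= => /eqP ->; rewrite linear0.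
  rewrite -dTp => le; have /eqP e : lker Tp == lker (Tp \o Tp).
    by rewrite -(dimv_leqif_eq s) eqn_leq le dimvS.
  by move=> TTv; apply/eqP; rewrite -memv_ker e memv_ker lfunE /= TTv.
have I0 : ((W :&: lker Tp) :&: Tp @: W = 0)%VS.
  apply/eqP; rewrite -subv0; apply/subvP => u /memv_capP[/memv_capP[_]].
  by rewrite memv_ker => /eqP Tu /memv_imgP[w wW uE]; rewrite uE kTp ?memv0// -uE.
split=> //; apply/eqP; rewrite eq_sym -dimv_leqif_eq.
  by rewrite dimv_disjoint_sum// limg_ker_dim.
rewrite subv_add capvSl; apply/subvP => u /memv_imgP[w wW ->].
by rewrite TpE iter_stable.
Qed.

End LinearAlgebra.

Section CommutingFamily.
Variables (F : numClosedFieldType) (V : vectType F) (Y : Type) (rho : Y -> 'End(V)).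
Hypothesis rhoC : forall y z v, rho y (rho z v) = rho z (rho y v).

Let stab (W : {vspace V}) := forall y w, w \in W -> rho y w \in W.

(** Induction on the dimension: an eigenspace in [W] of an operator that is not scalar on [W] is a
    smaller stable subspace. If all operators are scalar on [W], any non-zero vector of [W] will
    do. *)
Lemma common_eigenvector (W : {vspace V}) : W != 0%VS -> stab W ->
  exists w (chi : Y -> F), [/\ w \in W, w != 0 & forall y, rho y w = chi y *: w].
Proof.
elim: (\dim W).+1 {-2}W (ltnSn (\dim W)) => // d IH {}W dW W0 sW.
have [[y [c nc]]|sc] := pselect (exists y c, exists2 w, w \in W & w != 0 /\ rho y w = c *: w /\
    exists2 w', w' \in W & rho y w' != c *: w').
  case: nc => w wW [w0 [yw [w' w'W yw']]].
  pose K := (W :&: lker (rho y - c *: \1%VF))%VS.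
  have KP u : (u \in K) = (u \in W) && (rho y u == c *: u).
    by rewrite memv_cap memv_ker shift_lfunE subr_eq0.
  have [] := IH K.
  - rewrite ltnS in dW; apply: leq_trans dW.
    rewrite (ltn_leqif (dimv_leqif_sup (capvSl _ _))).
    by apply/negP => /subvP/(_ _ w'W); rewrite KP w'W (negPf yw').
  - by apply: contraNneq w0 => K0; rewrite -memv0 -K0 KP wW yw eqxx.
  - move=> z u; rewrite !KP => /andP[uW /eqP yu]; rewrite sW//=.
    by rewrite rhoC yu linearZ.
  - by move=> u [chi [uK u0 uE]]; exists u, chi; split=> //; move: uK; rewrite KP => /andP[].
have ex y : exists c, forall w, w \in W -> rho y w = c *: w.
  have [c [w [wW w0 yw]]] := eigenvector_in W0 (sW y).
  exists c => w' w'W; apply: contrapT => /eqP yw'.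
  by apply: sc; exists y, c, w => //; split=> //; split=> //; exists w'.
have [chi chiP] := choice ex.
exists (vpick W), chi; split; rewrite ?vpick0 ?memv_pick// => y.
by apply: chiP; exact: memv_pick.
Qed.

(* Fitting's lemma splits a stable subspace as soon as some operator has two eigenvalues on it. *)
Lemma generalized_weight_ind (P : V -> Prop) :
  P 0 -> (forall u v, P u -> P v -> P (u + v)) ->
  (forall (chi : Y -> F) w v, w != 0 -> (forall y, rho y w = chi y *: w) ->
     (forall y, exists p, iter p (rho y - chi y *: \1%VF)%R v = 0) -> P v) ->
  forall v, P v.
Proof.
move=> P0 PD Pgen v.
suff H d (W : {vspace V}) : (\dim W < d)%N -> stab W -> forall u, u \in W -> P u.
  by apply: (H _ fullv (ltnSn _)) => [y w _|]; exact: memvf.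
elim: d W => // d IH W dW sW u uW.
have [W0|W0] := eqVneq W 0%VS.
  by move: uW; rewrite W0 memv0 => /eqP ->.
have [w [chi [wW w0 wE]]] := common_eigenvector W0 sW.
(* Either [W] consists of generalised weight vectors for [chi], or some [rho y - chi y] is not
   nilpotent at some [u1] in [W], and Fitting's lemma is applied to this operator. *)
have [all_nil|] := pselect (forall y u, u \in W ->
    exists p, iter p (rho y - chi y *: \1%VF)%R u = 0).
  by apply: (Pgen chi w) => // y; exact: all_nil.
move=> /existsNP[y] /existsNP[u1] /not_implyP[u1W nu1].
set T := (rho y - chi y *: \1%VF)%R.
have TE x : T x = rho y x - chi y *: x by exact: shift_lfunE.
have TW x : x \in W -> T x \in W by move=> xW; rewrite TE memvB ?memvZ//; exact: sW.
have TC z x : T (rho z x) = rho z (T x) by rewrite !TE rhoC [RHS]linearB [in RHS]linearZ.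
have [p [Tp [TpE WE I0]]] := fitting TW.
have TpC z x : Tp (rho z x) = rho z (Tp x).
  by rewrite !TpE; elim: (p) => //= q ->; rewrite TC.
(* Both summands are proper: [u1] is not in the kernel part, and the common eigenvector [w], which
   [Tp] kills, is not in the image part. *)
have u1K : u1 \notin lker Tp.
  by apply/negP; rewrite memv_ker TpE => /eqP e; apply: nu1; exists p.+1.
have wT : w \notin (Tp @: W)%VS.
  have Tw : T w = 0 by rewrite TE wE subrr.
  have {}Tw : Tp w = 0.
    by rewrite TpE iterSr Tw; elim: (p) => [|r] /=; [by []|move=> ->; exact: linear0].
  by apply: contra w0 => wT; rewrite -memv0 -I0 !memv_cap wW wT memv_ker Tw eqxx.
move: uW; rewrite WE => /memv_addP[u2 u2K [u3 u3T ->]]; apply: PD.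
- apply: (IH (W :&: lker Tp)%VS) u2K.
    rewrite ltnS in dW; apply: leq_trans dW.
    rewrite (ltn_leqif (dimv_leqif_sup (capvSl _ _))).
    apply/negP => /subvP/(_ _ u1W); rewrite memv_cap => /andP[_].
    by apply/negP.
  move=> z x; rewrite !memv_cap !memv_ker => /andP[xW /eqP Tx].
  by rewrite sW// TpC Tx linear0 eqxx.
- apply: (IH (Tp @: W)%VS) u3T.
    rewrite ltnS in dW; apply: leq_trans dW.
    rewrite (ltn_leqif (dimv_leqif_sup _)).
      by apply/negP => /subvP/(_ _ wW); apply/negP.
    by apply/subvP => x /memv_imgP[x' x'W ->]; rewrite TpE iter_stable.
  move=> z x /memv_imgP[x' x'W ->]; rewrite -TpC; apply: memv_img.
  exact: sW.
Qed.

End CommutingFamily.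

(** * Root space decomposition *)

Section LinearMaps.
Variables (F : numClosedFieldType) (U W : lmodType F) (f : U -> W).
Hypothesis fL : linear f.

Lemma lin0 : f 0 = 0.
Proof. by have := fL (-1) 0 0; rewrite scaler0 addr0 scaleN1r addNr. Qed.

Lemma linD u v : f (u + v) = f u + f v.
Proof. by have := fL 1 u v; rewrite !scale1r. Qed.

Lemma linZ a u : f (a *: u) = a *: f u.
Proof. by have := fL a u 0; rewrite lin0 !addr0. Qed.

Lemma linN u : f (- u) = - f u.
Proof. by rewrite -scaleN1r linZ scaleN1r. Qed.

Lemma linB u v : f (u - v) = f u - f v.
Proof. by rewrite linD linN. Qed.

Lemma lin_sum I (r : seq I) (P : pred I) E :
  f (\sum_(i <- r | P i) E i) = \sum_(i <- r | P i) f (E i).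
Proof. by elim/big_rec2: _ => [|i u v _ <-]; [exact: lin0|exact: linD]. Qed.

End LinearMaps.

Section LieBasics.
Variables (F : numClosedFieldType) (L : lmodType F) (br : L -> L -> L).
Hypothesis brP : lie_algebra br.

Lemma lie_linr x : linear (br x). Proof. by case: brP. Qed.

Lemma lie_linl y : linear (br^~ y). Proof. by case: brP. Qed.

Lemma lie_anti x y : br x y = - br y x.
Proof.
have [_ _ b0 _] := brP; have := b0 (x + y).
rewrite (linD (lie_linr _)) !(linD (lie_linl _) x y) !b0 add0r addr0.
by move/eqP; rewrite addrC addr_eq0 => /eqP.
Qed.

Lemma lie_jacobi x y z : br x (br y z) = br (br x y) z + br y (br x z).
Proof.
have [_ _ _ J] := brP; have := J x y z.
rewrite (lie_anti z (br x y)) (lie_anti z x) (linN (lie_linr _)).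
by move/eqP; rewrite subr_eq0 subr_eq => /eqP.
Qed.

End LieBasics.

(* By [e^(i+1), f] = (i+1) (t - i nu/2) e^i, an eigenvector c = e^i w of t killed by e with
   eigenvalue different from i nu/2 lies in the image of e^(i+1). *)
Lemma sl2_eigenvalue (F : numClosedFieldType) (V : vectType F) (e f t : 'End(V))
    (nu mu : F) N c :
  (forall v, e (f v) = f (e v) + t v) -> (forall v, t (e v) = e (t v) + nu *: e v) ->
  (forall v, iter N e v = 0) -> c != 0 -> e c = 0 -> t c = mu *: c ->
  exists i : nat, mu = i%:R * nu / 2.
Proof.
move=> ef te eN c0 ec tc; apply: contrapT => nmu.
have comm i v : iter i.+1 e (f v) =
    f (iter i.+1 e v) + i.+1%:R *: (t (iter i e v) - (i%:R * nu / 2) *: iter i e v).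
  elim: i => [|i IH] /=; first by rewrite !mul0r scale0r subr0 scale1r ef.
  rewrite /= in IH; rewrite IH [LHS]linearD /= ef -addrA; congr (_ + _).
  set u := iter i e v; rewrite [X in _ + X]linearZ [X in _ + _ *: X]linearB linearZ /=.
  rewrite te; set x := e (t u); set y := e u.
  set q := _ / _; set q' := _ / _.
  have -> : x + nu *: y + i.+1%:R *: (x - q *: y) =
      (1 + i.+1%:R) *: x + (nu - i.+1%:R * q) *: y.
    by rewrite scalerBr scalerA !scalerDl scale1r scaleNr addrACA.
  have -> : i.+2%:R *: (x + nu *: y - q' *: y) = i.+2%:R *: x + (i.+2%:R * (nu - q')) *: y.
    by rewrite -addrA -scalerBl scalerDr scalerA.
  congr (_ *: _ + _ *: _).
  by rewrite /q /q' -!natr1; field.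
(* If no [i] fits, [c] lies in the image of every power of [e], in particular of the N-th power,
   which is 0. *)
have : forall i, exists w, c = iter i e w.
  elim=> [|i [w cE]]; first by exists c.
  have [mi|mi] := eqVneq mu (i%:R * nu / 2); first by case: nmu; exists i.
  have h := comm i w; have e1 : iter i.+1 e w = 0 by rewrite iterS -cE ec.
  rewrite e1 -cE linear0 add0r tc -scalerBl scalerA in h.
  exists ((i.+1%:R * (mu - i%:R * nu / 2))^-1 *: f w).
  have [e' e'E] := exists_iter_lfun e i.+1.
  rewrite -e'E linearZ /= e'E h scalerA mulVf ?scale1r//.
  by rewrite mulf_neq0 ?pnatr_eq0// subr_eq0.
by move/(_ N) => [w cE]; rewrite cE eN eqxx in c0.
Qed.

Lemma last_nonzero_iter (F : numClosedFieldType) (V : lmodType F) (T : V -> V) p x :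
  x != 0 -> iter p T x = 0 -> exists2 q, iter q T x != 0 & T (iter q T x) = 0.
Proof.
move=> x0; elim: p => [|p IH] /=; first by move=> e; rewrite e eqxx in x0.
by move=> e; have [/IH//|n0] := eqVneq (iter p T x) 0; exists p.
Qed.

Lemma iter_zero (F : numClosedFieldType) (V : lmodType F) (T : V -> V) p :
  T 0 = 0 -> iter p T 0 = 0.
Proof. by move=> T0; elim: p => //= p ->. Qed.

(** * Simple roots as a basis of the dual of the Cartan subalgebra *)

Section DualSpace.
Variables (F : numClosedFieldType) (g : vectType F) (h : {vspace g}).

(** The functionals vanishing at [u] form a subspace; it contains the basis [Pi], hence all
    coordinate functionals. *)
Lemma dual_separates (Pi : seq (dual h)) (u : subvs_of h) : basis_of fullv Pi ->
  (forall alpha, alpha \in Pi -> alpha u = 0) -> u = 0.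
Proof.
move=> /span_basis PiE Piu.
have [Z ZP] : exists Z : {vspace dual h}, forall phi, phi \in Z <-> phi u = 0.
  apply: (exists_vspace (P := fun phi : dual h => phi u = 0)); first by rewrite lfunE.
  by move=> a phi phi' e e'; rewrite add_lfunE scale_lfunE e e' scaler0 addr0.
have phiu (phi : dual h) : phi u = 0.
  apply/ZP; have /subvP : (<<Pi>> <= Z)%VS by apply/span_subvP => alpha /Piu /ZP.
  by apply; rewrite PiE memvf.
rewrite (coord_vbasis (memvf u)) big1// => i _.
pose phi : dual h := linfun (coord (vbasis {:subvs_of h}) i : subvs_of h -> F^o).
by have := phiu phi; rewrite lfunE /= => ->; rewrite scale0r.
Qed.

(** Evaluation at the elements of [Pi] is injective, hence surjective by dimension, and [H] is a
    preimage of the all-ones vector. It serves to measure heights of roots. *)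
Lemma dual_basis_surj (Pi : seq (dual h)) : basis_of fullv Pi ->
  exists H : subvs_of h, forall alpha, alpha \in Pi -> alpha H = 1.
Proof.
move=> bPi.
pose f (u : subvs_of h) : 'rV[F]_(size Pi) := \row_i (Pi`_i u : F).
have fL : linear f by move=> a u v; apply/rowP => i; rewrite !mxE linearP.
pose f' := linfun f.
have f'E u : f' u = f u by rewrite linear_lfunE.
have k0 : lker f' == 0%VS.
  apply/lker0P => u v; rewrite !f'E => e; apply/eqP; rewrite -subr_eq0; apply/eqP.
  apply: (dual_separates bPi) => alpha aPi.
  have := congr1 (fun r : 'rV[F]_(size Pi) => r 0 (Ordinal (etrans (index_mem alpha Pi) aPi))) e.
  by rewrite !mxE /= nth_index// linearB /= => ->; rewrite subrr.
have full : limg f' = fullv.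
  have sz : size Pi = \dim {:dual h}.
    by case/andP: bPi => /eqP <- /eqP.
  apply/eqP; rewrite -(dimv_leqif_eq (subvf _)).
  have := limg_ker_dim f' fullv; rewrite (eqP k0) capv0 dimv0 add0n => ->.
  by rewrite !dimvf [X in _ == X]mul1n sz dimvf [X in _ == X]muln1.
have := memvf (const_mx 1 : 'rV[F]_(size Pi)); rewrite -full => /memv_imgP[H _ HE].
exists H => alpha aPi.
have := congr1 (fun r : 'rV[F]_(size Pi) => r 0 (Ordinal (etrans (index_mem alpha Pi) aPi))) HE.
by rewrite f'E !mxE /= nth_index.
Qed.

End DualSpace.

Lemma iter_swap (T : Type) (S S' : T -> T) p q u : (forall u, S (S' u) = S' (S u)) ->
  iter p S (iter q S' u) = iter q S' (iter p S u).
Proof.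
move=> SS'; have {}SS' v : S (iter q S' v) = iter q S' (S v).
  by elim: q => //= q <-.
by elim: p => //= p ->.
Qed.

Section RootDecomposition.
Variables (F : numClosedFieldType) (g : vectType F) (br : g -> g -> g).
Variables (form : g -> g -> F) (h : {vspace g}) (Pi : seq (dual h)).
Hypotheses (g_lie : lie_algebra br) (h_cartan : cartan_subalgebra br fullv h).
Hypotheses (Pi_simple : simple_roots br fullv Pi) (form_inv : invariant_form br form).

Let brl := lie_linl g_lie.
Let brr := lie_linr g_lie.
Let ad x : 'End(g) := linfun (br x).
Let adE x y : ad x y = br x y. Proof. by rewrite linear_lfunE. Qed.

Let sh z a u := br z u - a *: u.
Let sh_lin z a : linear (sh z a).
Proof.
by move=> b u v; rewrite /sh brr scalerDr scalerBr !scalerA mulrC opprD addrACA.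
Qed.
(** Generalised weight vectors. The exponent may depend on [y], and [alpha] is a bare function so
    that [fun=> 0] can stand for the zero weight. *)
Let genw (alpha : subvs_of h -> F) x :=
  forall y : subvs_of h, exists p, iter p (sh (vsval y) (alpha y)) x = 0.

Let br0 x : br x 0 = 0. Proof. exact: lin0. Qed.
Let br0l x : br 0 x = 0. Proof. exact: (lin0 (brl x)). Qed.
Let sh0 z a : sh z a 0 = 0. Proof. exact: lin0. Qed.

Let formDr x y z : form x (y + z) = form x y + form x z.
Proof. by case: form_inv => fL _ _ _ _; have := fL x 1 y z; rewrite scale1r mul1r. Qed.
Let form0r x : form x 0 = 0.
Proof. by apply: (addrI (form x 0)); rewrite -formDr !addr0. Qed.
Let formZr x a y : form x (a *: y) = a * form x y.
Proof. by case: form_inv => fL _ _ _ _; have := fL x a y 0; rewrite form0r !addr0. Qed.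
Let formC x y : form x y = form y x. Proof. by case: form_inv. Qed.
Let form_ad z x y : form (br z x) y = - form x (br z y).
Proof.
case: form_inv => _ _ _ fI _; rewrite (lie_anti g_lie) formC -scaleN1r formZr formC fI.
by rewrite mulN1r.
Qed.

Let iter_shD z a p u v : iter p (sh z a) (u + v) = iter p (sh z a) u + iter p (sh z a) v.
Proof. by elim: p => //= p ->; rewrite (linD (sh_lin _ _)). Qed.

(** Leibniz rule: [sh z (a + b)] applied to a bracket is the sum of the brackets with [sh z a]
    applied to the first and [sh z b] to the second argument. Each term lowers one exponent;
    induction on [p + q]. *)
Lemma generalized_weight_br z a b p q x y :
  iter p (sh z a) x = 0 -> iter q (sh z b) y = 0 ->
  iter (p + q) (sh z (a + b)) (br x y) = 0.
Proof.
have [N] := ubnP (p + q); elim: N p q x y => // N IH [|p] [|q] x y.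
- by move=> _ /= -> _.
- by move=> _ /= -> _; rewrite br0l -iterS iter_zero.
- by move=> _ _ /= ->; rewrite br0 iter_zero.
move=> le xp yq.
have e1 := IH p q.+1 (sh z a x) y le; have e2 := IH p.+1 q x (sh z b y).
rewrite addSnnS in e2; rewrite addSn iterSr.
have -> : sh z (a + b) (br x y) = br (sh z a x) y + br x (sh z b y).
  rewrite /sh (lie_jacobi g_lie) (linB (brl _)) (linB (brr _)).
  by rewrite (linZ (brl _)) (linZ (brr _)) scalerDl opprD addrACA.
by rewrite iter_shD e1 ?e2 ?addr0 -?iterSr.
Qed.

(** By invariance [form (sh z a x) y + form x (sh z b y)] equals [- (a + b) * form x y], and both
    terms on the left vanish by induction on [p + q]. *)
Lemma form_orthogonal z a b p q x y : a + b != 0 ->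
  iter p (sh z a) x = 0 -> iter q (sh z b) y = 0 -> form x y = 0.
Proof.
move=> ab; have [N] := ubnP (p + q); elim: N p q x y => // N IH [|p] [|q] x y.
- by move=> _ /= -> _; rewrite formC form0r.
- by move=> _ /= -> _; rewrite formC form0r.
- by move=> _ _ /= ->; rewrite form0r.
rewrite addSn ltnS addnS => le xp yq.
have h1 : form (sh z a x) y = 0 by apply: (IH p q.+1); rewrite ?addnS -?iterSr.
have h2 : form x (sh z b y) = 0 by apply: (IH p.+1 q) => //; rewrite ?addSn -?iterSr.
have : (a + b) * form x y = 0.
  move: h1 h2; rewrite /sh formC -[- (a *: x)]scaleN1r scalerA mulN1r formDr formZr formC form_ad.
  rewrite -[- (b *: y)]scaleN1r scalerA mulN1r formDr formZr !mulNr (formC y x) => h1 h2.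
  have := congr2 +%R h1 h2; rewrite addr0 => h3.
  by apply: oppr_inj; rewrite oppr0 -h3; ring.
by move/eqP; rewrite mulf_eq0 (negPf ab) => /eqP.
Qed.

Let valh (y : subvs_of h) : vsval y \in h. Proof. exact: subvsP. Qed.

(** The bracket lies in [h] and acts on a root vector as a commutator of two scalars. So all simple
    roots vanish on it, and they span the dual of [h]. *)
Lemma cartan_abelian y z : y \in h -> z \in h -> br y z = 0.
Proof.
move=> yh zh.
have [_ sh' _ _] := h_cartan; have yzh : br y z \in h by exact: sh'.
have [bPi rPi _] := Pi_simple.
suff : vsproj h (br y z) = 0 by move/(congr1 vsval); rewrite vsprojK.
apply: (dual_separates bPi) => alpha /rPi[_ [x _ [x0 xw]]].
have xwh u : u \in h -> br u x = alpha (vsproj h u) *: x.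
  by move=> uh; have := xw (vsproj h u); rewrite vsprojK.
have : alpha (vsproj h (br y z)) *: x = 0.
  rewrite -xwh//; have := lie_jacobi g_lie y z x.
  rewrite (xwh z)// (xwh y)// !(linZ (brr _)) (xwh y)// (xwh z)// !scalerA mulrC.
  by rewrite -[LHS]add0r => /addIr.
by move/eqP; rewrite scaler_eq0 (negPf x0) orbF => /eqP.
Qed.

Let cartan_swap y z v : y \in h -> z \in h -> br y (br z v) = br z (br y v).
Proof.
by move=> yh zh; rewrite (lie_jacobi g_lie) (cartan_abelian yh zh) br0l add0r.
Qed.

Let ad_comm (y z : subvs_of h) v : ad (vsval y) (ad (vsval z) v) = ad (vsval z) (ad (vsval y) v).
Proof.
by rewrite !adE cartan_swap.
Qed.

(** The decomposition for commuting operators, applied to the adjoint action of [h]. The true weight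
    vector [w] is kept because it certifies that a non-zero [alpha] is a root. *)
Lemma generalized_weight_sum_ind (P : g -> Prop) : P 0 -> (forall u v, P u -> P v -> P (u + v)) ->
  (forall (alpha : dual h) w, w != 0 -> weight_vector br alpha w ->
     forall x, genw alpha x -> P x) -> forall x, P x.
Proof.
move=> P0 PD Pg; apply: (generalized_weight_ind ad_comm P0 PD) => chi w v w0 wE vg.
(* So far [chi] is a mere function; it is linear because it gives the eigenvalues on one fixed
   non-zero vector. *)
have chiL : linear (chi : subvs_of h -> F^o).
  move=> a y z; apply/eqP; rewrite -subr_eq0.
  have : (chi (a *: y + z) - (a * chi y + chi z)) *: w = 0.
    rewrite scalerBl scalerDl -scalerA -!wE !adE linearP.
    by rewrite /= (brl w) subrr.
  by move/eqP; rewrite scaler_eq0 (negPf w0) orbF.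
pose alpha : dual h := linfun (chi : subvs_of h -> F^o).
have aE y : alpha y = chi y by rewrite linear_lfunE.
apply: (Pg alpha w w0) => [y|y]; first by rewrite -adE wE aE.
have [p pE] := vg y; exists p; rewrite -pE; apply: eq_iter => u.
by rewrite shift_lfunE adE aE.
Qed.

(** Starting from [x] outside [h], one basis element of [h] is treated after the other to reach an
    element outside [h] that all of them send into [h]. This contradicts that [h] is its own
    normaliser. *)
Lemma cartan_generalized_weight0 x : genw (fun=> 0) x -> x \in h.
Proof.
move=> gx; apply: contraT => xh.
have [_ hst _ self] := h_cartan.
suff [x' [x'h _ x'P]] : exists x', [/\ x' \notin h, genw (fun=> 0) x' &
    forall y, y \in tval (vbasis h) -> br y x' \in h].
  have hx' y : y \in h -> br x' y \in h.
    move=> yh; rewrite (lie_anti g_lie) memvN (coord_vbasis yh) (lin_sum (brl _)).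
    apply: memv_suml => i _; rewrite (linZ (brl _)) memvZ// x'P// mem_nth ?size_tuple//.
  by rewrite (self x' (memvf _) hx') in x'h.
have sub : {subset tval (vbasis h) <= h} by move=> y; exact: vbasis_mem.
elim: (tval (vbasis h)) sub => [|y s IH] sub; first by exists x.
have [x1 [x1h gx1 x1s]] : exists x1, [/\ x1 \notin h, genw (fun=> 0) x1 &
    forall z, z \in s -> br z x1 \in h].
  by apply: IH => z zs; apply: sub; rewrite in_cons zs orbT.
have yh : y \in h by apply: sub; rewrite mem_head.
have exp : exists p, iter p (br y) x1 \in h.
  have [p] := gx1 (vsproj h y); rewrite vsprojK// => e; exists p.
  rewrite (eq_iter (f' := sh y 0)) ?e ?mem0v// => u.
  by rewrite /sh scale0r subr0.
(* By minimality the iterate just before the first one in [h] is outside [h], while [y] sends it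
   into [h]. *)
case: (ex_minnP exp) => -[|p] /= yp pmin; first by rewrite yp in x1h.
exists (iter p (br y) x1); split.
- by apply/negP => /pmin; rewrite ltnn.
- move=> z; have [r rE] := gx1 z; exists r.
  rewrite iter_swap ?rE ?iter_zero// => u.
  by rewrite /sh (cartan_swap _ (valh z) yh) (linB (brr _)) (linZ (brr _)).
- move=> z; rewrite in_cons => /predU1P[->//|zs].
  have zh : z \in h by apply: sub; rewrite in_cons zs orbT.
  (* As [h] is abelian, the actions of [z] and [y] commute, so the basis elements treated earlier
     still send the new element into [h]. *)
  have -> : br z (iter p (br y) x1) = iter p (br y) (br z x1).
    by apply: (iter_swap 1) => u; exact: cartan_swap.
  by elim: (p) => [|q]; [exact: x1s|exact: hst].
Qed.

Let h_gen0 u : u \in h -> genw (fun=> 0) u.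
Proof.
by move=> uh y; exists 1%N; rewrite /= /sh (cartan_abelian (valh y) uh) scale0r subr0.
Qed.

Let gen_orth (alpha beta : dual h) u v : genw alpha u -> genw beta v ->
  beta != - alpha -> form u v = 0.
Proof.
move=> gu gv ab; apply: contrapT => uv; case/negP: ab; apply/eqP/lfunP => y.
apply: contrapT => /eqP yab; have [p up] := gu y; have [q vq] := gv y.
apply: uv; apply: form_orthogonal up vq; apply: contra yab.
by rewrite opp_lfunE addrC addr_eq0.
Qed.

(** Generalised weight spaces of non-zero weight are orthogonal to [h], and the one of weight 0 lies
    in [h]; so [u] is orthogonal to all of [g]. *)
Let h_nondeg u : u \in h -> (forall y, y \in h -> form y u = 0) -> u = 0.
Proof.
move=> uh yu; case: form_inv => _ _ nd _ _; apply: nd => v.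
elim/generalized_weight_sum_ind: v => [|v w vu wu|alpha w _ _ v gv]; first exact: form0r.
  by rewrite formDr vu wu addr0.
have [a0|a0] := eqVneq alpha 0; last first.
  apply: (gen_orth (alpha := 0)) gv _; last by rewrite oppr0.
  by move=> y; rewrite lfunE; exact: h_gen0.
rewrite formC yu//; apply: cartan_generalized_weight0 => y; have [p pE] := gv y; exists p.
by rewrite -[RHS]pE a0 lfunE.
Qed.

Let weight_gen alpha a : weight_vector br alpha a -> genw alpha a.
Proof. by move=> aw y; exists 1%N; rewrite /= /sh aw subrr. Qed.

(** Bracketing with [a] adds [alpha] to generalised weights. If the iterate of order [size s] were
    non-zero at [v], an element [y] with [alpha y] non-zero would have [size s + 1] distinct
    eigenvalues, all in the list [s]. *)
Lemma root_vector_nilpotent (alpha : dual h) a : alpha != 0 -> weight_vector br alpha a ->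
  exists N, forall v, iter N (br a) v = 0.
Proof.
move=> a0 aw.
have [y ya] : exists y, alpha y != 0.
  apply: contrapT => nex; case/negP: a0; apply/eqP/lfunP => y; rewrite lfunE.
  by apply: contrapT => /eqP ya; apply: nex; exists y.
have [s sP] := finite_spectrum (ad (vsval y)).
exists (size s) => v; elim/generalized_weight_sum_ind: v => [|u v uN vN|chi w _ _ v gv].
- by rewrite iter_zero.
- have itD x y' : iter (size s) (br a) (x + y') = iter (size s) (br a) x + iter (size s) (br a) y'.
    by elim: (size s) => //= k ->; rewrite (linD (brr _)).
  by rewrite itD uN vN addr0.
apply: contrapT => /eqP vN.
pose c k : F := chi y + alpha y *+ k.
have vk k : (k <= size s)%N -> iter k (br a) v != 0.
  move=> ks; apply: contra vN => /eqP e.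
  by rewrite -(subnK ks) iterD e iter_zero.
have gk k : exists p, iter p (sh (vsval y) (c k)) (iter k (br a) v) = 0.
  elim: k => [|k [p pE]]; first by rewrite /c addr0; exact: gv.
  exists (1 + p)%N; rewrite iterS /c mulrSr addrA addrC.
  by apply: generalized_weight_br => //=; rewrite /sh aw subrr.
have ck k : (k <= size s)%N -> c k \in s.
  move=> /vk v0; have [p pE] := gk k.
  have [q q0 e] := last_nonzero_iter v0 pE.
  apply: (sP _ _ q0); rewrite adE; apply/eqP; rewrite -subr_eq0; apply/eqP.
  exact: e.
have : (size [seq c k | k <- iota 0 (size s).+1] <= size s)%N.
  apply: uniq_leq_size; last first.
    by move=> _ /mapP[k + ->]; rewrite mem_iota add0n ltnS => /ck.
  rewrite map_inj_uniq ?iota_uniq// => i j /addrI.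
  exact: mulrIn.
by rewrite size_map size_iota ltnn.
Qed.

(** Non-degeneracy gives [b] of opposite weight with [form a b] non-zero; put [t = [a, b]]. The sl_2
    relations of [a], [b], [t] show that an element of generalised weight [- alpha] orthogonal to
    [a] is 0. For [z] in [h] the operator [ad z + alpha z] has values orthogonal to [a], so it
    vanishes on the generalised weight space. *)
Lemma opposite_weight_space (alpha : dual h) a : a != 0 -> alpha != 0 -> weight_vector br alpha a ->
  (exists2 b, b != 0 & genw (- alpha) b) /\
  forall x, genw (- alpha) x -> weight_vector br (- alpha) x.
Proof.
move=> a0 al0 aw.
have [b gb ab] : exists2 b, genw (- alpha) b & form a b != 0.
  apply: contrapT => nb; case/negP: a0; apply/eqP.
  case: form_inv => _ _ nd _ _; apply: nd => v.
  elim/generalized_weight_sum_ind: v => [|v w vu wu|chi w _ _ v gv]; first exact: form0r.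
    by rewrite formDr vu wu addr0.
  have [chiE|] := eqVneq chi (- alpha); last exact: gen_orth (weight_gen aw) gv.
  by apply: contrapT => /eqP av; apply: nb; exists v; rewrite -?chiE.
split; first by exists b => //; apply: contra ab => /eqP ->; rewrite form0r.
have gen_neg_br u : genw (- alpha) u -> br a u \in h.
  move=> gu; apply: cartan_generalized_weight0 => y; have [p pE] := gu y.
  exists (1 + p)%N; rewrite -[X in sh _ X](subrr (alpha y)).
  apply: generalized_weight_br; first by rewrite /= /sh aw subrr.
  by rewrite -[RHS]pE opp_lfunE.
have form_br y u : y \in h -> form y (br a u) = alpha (vsproj h y) * form a u.
  move=> yh; case: form_inv => _ _ _ fI _; rewrite -fI.
  by have := aw (vsproj h y); rewrite vsprojK// => ->; rewrite formC formZr formC.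
pose t := br a b; have th : t \in h by exact: gen_neg_br.
pose t' := vsproj h t; have t'E : vsval t' = t by rewrite vsprojK.
have ta : br t a = alpha t' *: a by rewrite -t'E aw.
have t'0 : t' != 0.
  apply: contra al0 => /eqP t0; apply/eqP/lfunP => y; rewrite lfunE.
  have := form_br _ b (valh y); rewrite -/t -t'E t0 form0r vsvalK => /esym/eqP.
  by rewrite mulf_eq0 (negPf ab) orbF => /eqP.
have e_f v : ad a (ad b v) = ad b (ad a v) + ad t v.
  by rewrite !adE (lie_jacobi g_lie) addrC.
have t_e v : ad t (ad a v) = ad a (ad t v) + alpha t' *: ad a v.
  by rewrite !adE (lie_jacobi g_lie) ta (linZ (brl _)) addrC.
have [N aN] := root_vector_nilpotent al0 aw.
have {}aN v : iter N (ad a) v = 0 by rewrite -[RHS](aN v); apply: eq_iter => u; rewrite adE.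
(* Otherwise [t] commutes with the action of [a], and the last non-zero iterate of [a] on a root
   vector for a simple root [beta] is an eigenvector of [t] with eigenvalue [beta t']. The sl_2
   lemma with [nu = 0] makes this 0, although some simple root is non-zero at [t']. *)
have nu0 : alpha t' != 0.
  apply/eqP => nu0; case: Pi_simple => bPi rPi _.
  have [beta betaPi bt] : exists2 beta, beta \in Pi & beta t' != 0.
    apply: contrapT => nb; case/negP: t'0; apply/eqP/(dual_separates bPi) => beta bPi'.
    by apply: contrapT => /eqP bt; apply: nb; exists beta.
  have [_ [x _ [x0 xw]]] := rPi _ betaPi.
  have [q c0 ac] := last_nonzero_iter x0 (aN x).
  have tc : ad t (iter q (ad a) x) = beta t' *: iter q (ad a) x.
    have -> : ad t (iter q (ad a) x) = iter q (ad a) (ad t x).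
      by apply: (@iter_swap _ (ad t) (ad a) 1) => u; rewrite t_e nu0 scale0r addr0.
    have [e eE] := exists_iter_lfun (ad a) q.
    by rewrite -eE /= adE -t'E xw linearZ /= eE.
  have [i iE] := sl2_eigenvalue e_f t_e aN c0 ac tc.
  by move: bt; rewrite iE nu0 mulr0 mul0r eqxx.
have gsh z al u : z \in h -> genw (- alpha) u -> genw (- alpha) (sh z al u).
  move=> zh gu y; have [p pE] := gu y; exists p.
  rewrite -[RHS](sh0 z al) -pE.
  apply: (@iter_swap _ (sh (vsval y) ((- alpha) y)) (sh z al) p 1) => v.
  rewrite /sh (linB (brr _)) (linZ (brr _)) (linB (brr _)) (linZ (brr _)).
  rewrite (cartan_swap _ (valh y) zh) !scalerBr !scalerA !opprB !addrA.
  by rewrite (mulrC al) addrAC [in RHS]addrAC; congr (_ + _); exact: addrAC.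
have form_sh z u : z \in h -> form a (sh z (- alpha (vsproj h z)) u) = 0.
  move=> zh; rewrite /sh scaleNr opprK formDr formZr -[form a (br z u)]opprK -form_ad.
  have := aw (vsproj h z); rewrite vsprojK// => ->.
  by rewrite formC formZr formC addNr.
(* The last non-zero iterate [c'] of [c] under [ad t + alpha t'] is an eigenvector of [t], still
   orthogonal to [a]. Its bracket with [a] lies in [h] and is orthogonal to [h], hence is 0, and the
   sl_2 lemma yields [(i + 2) * alpha t' = 0]. *)
have K0 c : genw (- alpha) c -> form a c = 0 -> c = 0.
  move=> gc ac; apply: contrapT => /eqP c0.
  have [p pE] := gc t'; rewrite t'E opp_lfunE in pE.
  have [q q0 tc] := last_nonzero_iter c0 pE.
  set c' := iter q _ c in q0 tc.
  have gc' : genw (- alpha) c'.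
    by rewrite /c'; elim: (q) => //= r; exact: gsh.
  have ac' : form a c' = 0.
    by rewrite /c'; case: (q) => //= r; rewrite -/t' form_sh.
  have brac : ad a c' = 0.
    rewrite adE; apply: h_nondeg; first exact: gen_neg_br.
    by move=> y yh; rewrite form_br// ac' mulr0.
  have tc' : ad t c' = - alpha t' *: c'.
    by rewrite adE; apply/eqP; rewrite -subr_eq0; apply/eqP.
  have [i iE] := sl2_eigenvalue e_f t_e aN q0 brac tc'.
  have : (i%:R + 2) * alpha t' = 0.
    have -> : (i%:R + 2) * alpha t' = i%:R * alpha t' / 2 * 2 + 2 * alpha t'.
      by rewrite divfK ?pnatr_eq0// mulrDl.
    by rewrite -iE; ring.
  by apply/eqP; rewrite mulf_eq0 (negPf nu0) -natrD addn2 pnatr_eq0.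
move=> x gx y; apply/eqP; rewrite -subr_eq0; apply/eqP/K0.
  by rewrite opp_lfunE; apply: gsh.
by have := form_sh _ x (valh y); rewrite vsvalK opp_lfunE.
Qed.

(** For non-zero [alpha] the previous lemma is used twice: it first produces a true weight vector
    [b] of weight [- alpha], and applied to [b] it shows that everything of generalised weight
    [alpha] is a true weight vector. *)
Lemma root_space_ind (P : g -> Prop) : (forall u v, P u -> P v -> P (u + v)) ->
  (forall x, x \in h -> P x) ->
  (forall (alpha : dual h) x, Defs.root br fullv alpha -> weight_vector br alpha x -> P x) ->
  forall x, P x.
Proof.
move=> PD Ph Pr; apply: (generalized_weight_sum_ind (Ph 0 (mem0v h)) PD) => alpha w w0 ww x gx.
have [a0|a0] := eqVneq alpha 0.
  apply/Ph/cartan_generalized_weight0 => y; have [p pE] := gx y; exists p.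
  by rewrite -[RHS]pE a0 lfunE.
apply: (Pr alpha); first by split=> //; exists w; rewrite ?memvf.
have [[b b0 gb] neg] := opposite_weight_space w0 a0 ww.
have na0 : - alpha != 0 by rewrite oppr_eq0.
by have [_] := opposite_weight_space b0 na0 (neg _ gb); rewrite opprK; apply.
Qed.

End RootDecomposition.

(** * Highest weight modules *)

Section CyclicModule.
Variables (F : numClosedFieldType) (L V : lmodType F) (br : L -> L -> L).
Variables (act : L -> V -> V) (v : V) (H : L) (l : F) (neg : L -> Prop).
Hypotheses (actP : lie_module br act) (Hv : act H v = l *: v).
Hypothesis negP : forall f, neg f -> exists q : nat, br H f = - q.+1%:R *: f.
Hypothesis borel_neg_ind : forall P : L -> Prop,
  (forall x y, P x -> P y -> P (x + y)) ->
  (forall x c, act x v = c *: v -> P x) -> (forall f, neg f -> P f) -> forall x, P x.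

Let acr x : linear (act x). Proof. by case: actP. Qed.
Let acl u : linear (act^~ u). Proof. by case: actP. Qed.

Lemma act_swap x y u : act x (act y u) = act y (act x u) + act (br x y) u.
Proof. by case: actP => _ _ ->; rewrite addrC subrK. Qed.

(** Only elements of [neg] are applied to [v]; [cyclic_act] shows that the result is nevertheless
    stable under all of [L]. *)
Inductive cyclic : V -> Prop :=
| cyclic_gen : cyclic v
| cyclic_lin a u w : cyclic u -> cyclic w -> cyclic (a *: u + w)
| cyclic_neg f u : neg f -> cyclic u -> cyclic (act f u).

Lemma cyclic0 : cyclic 0.
Proof. by rewrite -(addNr v) -scaleN1r; apply: cyclic_lin; exact: cyclic_gen. Qed.

Lemma cyclicZ a u : cyclic u -> cyclic (a *: u).
Proof. by move=> cu; rewrite -[_ *: _]addr0; apply: cyclic_lin => //; exact: cyclic0. Qed.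

Lemma cyclicD u w : cyclic u -> cyclic w -> cyclic (u + w).
Proof. by move=> cu cw; rewrite -[u]scale1r; exact: cyclic_lin. Qed.

(** Induction on [u] with [x] arbitrary: [x] moves past [f] at the cost of the bracket of [x] and
    [f], again an element of [L]. On [v] itself the decomposition of [L] applies. *)
Lemma cyclic_act x u : cyclic u -> cyclic (act x u).
Proof.
move=> cu; elim: cu x => [|a u' w _ IHu _ IHw|f u' nf cu' IH] x.
- apply: (borel_neg_ind (P := fun x => cyclic (act x v))) => [y z cy cz|y c ->|f nf].
  + by rewrite (linD (acl _)); exact: cyclicD.
  + exact/cyclicZ/cyclic_gen.
  + by apply: cyclic_neg => //; exact: cyclic_gen.
- by rewrite acr; exact: cyclic_lin.
- by rewrite act_swap; apply: cyclicD => //; exact: cyclic_neg.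
Qed.

Lemma cyclic_min (Q : V -> Prop) : Q v -> (forall a u w, Q u -> Q w -> Q (a *: u + w)) ->
  (forall x u, Q u -> Q (act x u)) -> forall u, cyclic u -> Q u.
Proof. by move=> Qv QD Qa u; elim=> // *; [exact: QD|exact: Qa]. Qed.

(** Sums of eigenvectors of [H]; the shift [j.+1] keeps their eigenvalues different from [l]. *)
Inductive lower : V -> Prop :=
| lower0 : lower 0
| lower_add u w j : lower u -> act H w = (l - j.+1%:R) *: w -> lower (u + w).

Let lowerD u w : lower u -> lower w -> lower (u + w).
Proof.
move=> lu; elim=> [|w1 w2 j _ IH Hw]; first by rewrite addr0.
by rewrite addrA; exact: lower_add Hw.
Qed.

Let lowerZ a u : lower u -> lower (a *: u).
Proof.
elim=> [|w1 w2 j _ IH Hw]; first by rewrite scaler0; exact: lower0.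
rewrite scalerDr; apply: (lower_add (j := j)) => //.
by rewrite (linZ (acr _)) Hw !scalerA mulrC.
Qed.

Let neg_weight f u mu : neg f -> act H u = mu *: u ->
  exists q : nat, act H (act f u) = (mu - q.+1%:R) *: act f u.
Proof.
move=> /negP[q qE] Hu; exists q.
by rewrite act_swap Hu qE (linZ (acr _)) (linZ (acl _)) -scalerDl.
Qed.

Let lower_neg f u : neg f -> lower u -> lower (act f u).
Proof.
move=> nf; elim=> [|w1 w2 j _ IH Hw]; first by rewrite (lin0 (acr _)); exact: lower0.
rewrite (linD (acr _)); have [q qE] := neg_weight nf Hw.
apply: (lower_add (j := j.+1 + q)) => //.
by rewrite qE -addrA -opprD -natrD addnS.
Qed.

Lemma cyclic_lower u : cyclic u -> exists c, lower (u - c *: v).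
Proof.
elim=> [|a u' w _ [c lu] _ [d lw]|f u' nf _ [c lu]].
- by exists 1; rewrite scale1r subrr; exact: lower0.
- exists (a * c + d); rewrite scalerDl opprD addrACA -scalerA -scalerBr.
  by apply: lowerD => //; exact: lowerZ.
- exists 0; rewrite scale0r subr0 -[u'](subrK (c *: v)) (linD (acr _)).
  apply: lowerD; first exact: lower_neg.
  rewrite (linZ (acr _)); apply: lowerZ.
  have [q qE] := neg_weight nf Hv.
  by rewrite -[act f v]add0r; apply: lower_add qE; exact: lower0.
Qed.

(** The product of the operators [H - (l - (j + 1))] for [j < N]; it annihilates a given element of
    [lower] once [N] is large. *)
Let D N u := iteri N (fun j w => act H w - (l - j.+1%:R) *: w) u.

Let D_lin N : linear (D N).
Proof.
elim: N => //= N IH a u w.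
by rewrite /= -/(D N _) IH acr scalerDr !scalerBr !scalerA [_ * a]mulrC opprD addrACA.
Qed.

Let D_weight N u mu : act H u = mu *: u ->
  D N u = (\prod_(j < N) (mu - l + j.+1%:R)) *: u.
Proof.
move=> Hu; elim: N => [|N IH]; first by rewrite big_ord0 scale1r.
rewrite /= -/(D N u) IH big_ord_recr /= (linZ (acr _)) Hu !scalerA -scalerBl.
by congr (_ *: _); ring.
Qed.

Let D_lower u : lower u -> exists N0, forall N, (N0 <= N)%N -> D N u = 0.
Proof.
elim=> [|w1 w2 j _ [N0 IH] Hw]; first by exists 0%N => N _; exact: (lin0 (D_lin N)).
exists (maxn N0 j.+1) => N; rewrite geq_max => /andP[N0N jN].
rewrite (linD (D_lin N)) IH// add0r (D_weight _ Hw) (bigD1 (Ordinal jN))//=.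
by rewrite [X in X * _](_ : _ = 0) ?mul0r ?scale0r//; ring.
Qed.

(** Write [u] as a multiple of [v] plus an element of [lower] and apply [D N]. Either the scalar by
    which [D N] acts on [u] is 0, so that one of its factors is, or [u] is a multiple of [v]. *)
Lemma cyclic_eigenvector u mu : cyclic u -> u != 0 -> act H u = mu *: u ->
  (mu = l /\ exists c, u = c *: v) \/ exists j : nat, mu = l - j.+1%:R.
Proof.
move=> /cyclic_lower[c cu] u0 Hu; have [N /(_ N (leqnn N))] := D_lower cu.
rewrite (linB (D_lin N)) (linZ (D_lin N)) (D_weight _ Hu) (D_weight _ Hv).
set K := \prod_(j < N) _ => /eqP; rewrite subr_eq0 => /eqP e.
have [/eqP/prodf_eq0[j _ /eqP jE]|K0] := eqVneq K 0.
  by right; exists j; apply/eqP; rewrite -subr_eq0 opprB addrA addrAC jE.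
left; have [d uE] : exists d, u = d *: v.
  by eexists; rewrite -[u]scale1r -(mulVf K0) -scalerA e !scalerA.
split; last by exists d.
apply/eqP; rewrite -subr_eq0; apply: contraNT u0 => ml.
have : (mu - l) *: u = 0 by rewrite scalerBl -Hu uE (linZ (acr _)) Hv !scalerA mulrC subrr.
by move/eqP; rewrite scaler_eq0 (negPf ml).
Qed.

End CyclicModule.

(** * Isomorphisms between submodules *)

Section IsoOn.
Variables (F : numClosedFieldType) (g : vectType F).

(** The map is defined on the ambient space, while injectivity and equivariance are required on [U]
    only; this avoids passing to subspaces as types. *)
Definition iso_on (V W : vectType F) (act : g -> V -> V) (U : {vspace V})
    (act' : g -> W -> W) (U' : {vspace W}) :=
  exists phi : 'Hom(V, W), [/\ (phi @: U)%VS = U', forall u, u \in U -> phi u = 0 -> u = 0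
    & forall x u, u \in U -> phi (act x u) = act' x (phi u)].

(** The inverse is a pseudo-inverse of [phi] composed with the projection to [U], projected back to
    [U]. *)
Lemma iso_on_sym (V W : vectType F) (act : g -> V -> V) U (act' : g -> W -> W) U' :
  stable act fullv U -> iso_on act U act' U' -> iso_on act' U' act U.
Proof.
move=> sU [phi [phiU phi0 phiE]].
pose q := (phi \o projv U)%VF; pose chi := (projv U \o q^-1)%VF.
have chiK u : u \in U -> chi (phi u) = u.
  move=> uU; have qu : q u = phi u by rewrite comp_lfunE projv_id.
  have : q (q^-1%VF (phi u)) = phi u by rewrite limg_lfunVK// -qu memv_img ?memvf.
  rewrite comp_lfunE -[chi _]/((projv U \o q^-1)%VF _) comp_lfunE => e.
  by apply/eqP; rewrite -subr_eq0; apply/eqP/phi0; rewrite ?memvB ?memv_proj// linearB /= e subrr.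
exists chi; split.
- apply/vspaceP => u; apply/memv_imgP/idP => [[w]|uU].
    by rewrite -phiU => /memv_imgP[u' u'U ->] ->; rewrite chiK.
  by exists (phi u); rewrite ?chiK// -phiU memv_img.
- by move=> w; rewrite -phiU => /memv_imgP[u uU ->]; rewrite chiK// => ->; rewrite linear0.
- move=> x w; rewrite -phiU => /memv_imgP[u uU ->].
  by rewrite -phiE// !chiK// sU ?memvf.
Qed.

Lemma iso_on_trans (V W X : vectType F) (act : g -> V -> V) U (act' : g -> W -> W) U'
    (act'' : g -> X -> X) U'' :
  iso_on act U act' U' -> iso_on act' U' act'' U'' -> iso_on act U act'' U''.
Proof.
move=> [phi [phiU phi0 phiE]] [psi [psiU psi0 psiE]]; exists (psi \o phi)%VF; split.
- by rewrite limg_comp phiU.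
- by move=> u uU; rewrite comp_lfunE => /psi0 e; apply: phi0 => //; rewrite e// -phiU memv_img.
- by move=> x u uU; rewrite !comp_lfunE phiE// psiE// -phiU memv_img.
Qed.

Lemma iso_on_twist (V W : vectType F) (act : g -> V -> V) U (act' : g -> W -> W) U' (f : g -> g) :
  iso_on act U act' U' -> iso_on (fun x => act (f x)) U (fun x => act' (f x)) U'.
Proof. by move=> [phi [? ? phiE]]; exists phi; split=> // x u; exact: phiE. Qed.

Lemma iso_on_irr_hw (V W : vectType F) (act : g -> V -> V) U (act' : g -> W -> W) U'
    (br : g -> g -> g) (h : {vspace g}) (Pi : seq (dual h)) (lambda : dual h) :
  (forall x, linear (act' x)) ->
  iso_on act U act' U' -> is_irr_hw br Pi lambda act U -> is_irr_hw br Pi lambda act' U'.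
Proof.
move=> act'L [phi [phiU phi0 phiE]] [[U0 sU irrU] [v [vU v0 vw vp]]]; split.
  split.
  - have [u uU u0] : exists2 u, u \in U & u != 0 by exists v.
    apply: contra u0 => /eqP U'0; apply/eqP/phi0 => //.
    by apply/eqP; rewrite -memv0 -U'0 -phiU memv_img.
  - move=> x w _; rewrite -phiU => /memv_imgP[u uU ->].
    by rewrite -phiE// memv_img// sU ?memvf.
  - move=> Z ZU' sZ; pose Y := (U :&: (phi @^-1: Z))%VS.
    have YU : (Y <= U)%VS by exact: capvSl.
    have sY : stable act fullv Y.
      move=> x u _; rewrite !memv_cap -!memv_preim => /andP[uU uZ].
      by rewrite sU ?memvf// phiE// sZ ?memvf.
    have ZE z : z \in Z -> exists2 u, u \in Y & z = phi u.
      move=> zZ; have := subvP ZU' _ zZ; rewrite -phiU => /memv_imgP[u uU zE].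
      by exists u => //; rewrite memv_cap -memv_preim uU -zE.
    case: (irrU _ YU sY) => YE; [left|right].
      apply/eqP; rewrite -subv0; apply/subvP => z /ZE[u + ->].
      by rewrite YE memv0 => /eqP ->; rewrite linear0 mem0v.
    apply/eqP; rewrite eqEsubv ZU'; apply/subvP => w; rewrite -phiU => /memv_imgP[u].
    by rewrite -YE memv_cap -memv_preim => /andP[_ ?] ->.
exists (phi v); split.
- by rewrite -phiU memv_img.
- by apply: contra v0 => /eqP/phi0 ->.
- by move=> y; rewrite -phiE// vw linearZ.
- by move=> alpha x ra na wx; rewrite -phiE// (vp _ _ ra na wx) linear0.
Qed.

End IsoOn.

(** * Uniqueness of the irreducible module of a given highest weight *)

Section HighestWeightUnique.
Variables (F : numClosedFieldType) (g : vectType F) (br : g -> g -> g).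
Variables (form : g -> g -> F) (h : {vspace g}) (Pi : seq (dual h)).
Hypotheses (g_lie : lie_algebra br) (h_cartan : cartan_subalgebra br fullv h).
Hypotheses (Pi_simple : simple_roots br fullv Pi) (form_inv : invariant_form br form).

Let neg f := exists alpha : dual h, [/\ Defs.root br fullv alpha, nonneg_comb Pi (- alpha)
  & weight_vector br alpha f].

(** All simple roots take the value 1 at [H], so a negative root takes minus the sum of its
    coefficients, which is non-zero because the root is. *)
Lemma exists_height : exists H : subvs_of h,
  forall f, neg f -> exists q : nat, br (vsval H) f = - q.+1%:R *: f.
Proof.
case: Pi_simple => bPi _ _; have [H HP] := dual_basis_surj bPi; exists H.
move=> f [alpha [[a0 _] [c cE] ->]].
have -> : alpha H = - (\sum_i c i)%:R.
  rewrite -[alpha]opprK opp_lfunE cE sum_lfunE natr_sum; congr (- _).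
  apply: eq_bigr => i _; rewrite -[in RHS](HP Pi`_i) ?mem_nth//.
  by elim: (c i) => [|k IH]; rewrite ?mulr0n ?lfunE// !mulrS add_lfunE IH.
case: (posnP (\sum_i c i)) => [c0|]; last by case: (\sum_i c i)%N => // q _; exists q.
case/negP: a0; rewrite -oppr_eq0 cE big1// => i _.
by move/eqP: c0; rewrite sum_nat_eq0 => /forallP/(_ i)/eqP ->.
Qed.

(** Root space decomposition: [h] and the positive root vectors have [v] as an eigenvector, and the
    other root vectors belong to [neg]. *)
Let borel_neg (V : vectType F) (act : g -> V -> V) (lambda : dual h) v :
  weight_vector act lambda v ->
  (forall (alpha : dual h) x, Defs.root br fullv alpha -> nonneg_comb Pi alpha ->
        weight_vector br alpha x -> act x v = 0) ->
  forall P : g -> Prop, (forall x y, P x -> P y -> P (x + y)) ->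
  (forall x c, act x v = c *: v -> P x) -> (forall f, neg f -> P f) -> forall x, P x.
Proof.
move=> vw vp P PD Pb Pn; apply: (root_space_ind g_lie h_cartan Pi_simple form_inv PD).
  by move=> x xh; apply: (Pb _ (lambda (vsproj h x))); rewrite -vw vsprojK.
move=> alpha x ra xw; case: Pi_simple => _ _ /(_ _ ra)[pos|ng].
  by apply: (Pb _ 0); rewrite scale0r (vp alpha).
by apply: Pn; exists alpha.
Qed.

Section Pair.
Variables (V W : vectType F) (act : g -> V -> V) (act' : g -> W -> W).

Definition pair_act x (p : V * W) : V * W := (act x p.1, act' x p.2).

Lemma pair_act_module : lie_module br act -> lie_module br act' -> lie_module br pair_act.
Proof.
move=> [r l b] [r' l' b']; split=> [x a p q|p a x y|x y p]; rewrite /pair_act.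
- by rewrite r r'.
- by congr (_, _); [exact: l|exact: l'].
- by rewrite b b'.
Qed.
End Pair.

(** The submodule generated by [(v, w)] in the direct sum of the two modules is the graph of the
    isomorphism. *)
Theorem irr_hw_unique (V W : vectType F) (act : g -> V -> V) (act' : g -> W -> W)
    (U : {vspace V}) (U' : {vspace W}) (lambda : dual h) :
  lie_module br act -> lie_module br act' ->
  is_irr_hw br Pi lambda act U -> is_irr_hw br Pi lambda act' U' ->
  iso_on act U act' U'.
Proof.
move=> actP act'P [[U0 sU irrU] [v [vU v0 vw vp]]] [[U'0 sU' irrU'] [w [wU w0 ww wp]]].
have aP := pair_act_module actP act'P.
have [actr actl _] := actP; have [actr' actl' _] := act'P.
set a := pair_act act act' in aP.
have pw : weight_vector a lambda (v, w).
  by move=> y; rewrite /a /pair_act /= vw ww.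
have pp (alpha : dual h) x : Defs.root br fullv alpha -> nonneg_comb Pi alpha ->
        weight_vector br alpha x -> a x (v, w) = 0.
  by move=> ra na xw; rewrite /a /pair_act /= (vp _ _ ra na xw) (wp _ _ ra na xw).
have [H negH] := exists_height.
pose cyc := cyclic a (v, w) neg.
have cyc_act x p : cyc p -> cyc (a x p) by apply: (cyclic_act aP) => //; exact: borel_neg pw pp.
have cycL c p q : cyc p -> cyc q -> cyc (c *: p + q) by exact: cyclic_lin.
have cyc_top p : cyc p -> p != 0 -> a (vsval H) p = lambda H *: p -> exists c, p = c *: (v, w).
  move=> cp p0 /(cyclic_eigenvector aP (pw H) negH cp p0)[[]//|[j]].
  move/eqP; rewrite -subr_eq0 opprB addrCA subrr addr0 pnatr_eq0.
  done.
have cycU p : cyc p -> p.1 \in U /\ p.2 \in U'.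
  apply: (@cyclic_min _ _ _ a (v, w) neg (fun p => p.1 \in U /\ p.2 \in U')) => [//||] /=.
  - move=> c p' q [p1 p2] [q1 q2].
    by rewrite !memvD ?memvZ.
  - by move=> x p' [p1 p2]; split; [apply: sU|apply: sU']; rewrite ?memvf.
have cyc0 : cyc 0 by exact: cyclic0.
(* The second components of such pairs form a submodule of [U']. If it were all of [U'], then
   [(0, w)], which has the top eigenvalue, would be a multiple of [(v, w)]. *)
have inj1 w' : cyc (0, w') -> w' = 0.
  have [|N NP] := @exists_vspace F W (fun u => cyc (0, u)) cyc0.
    by move=> c p q cp cq; have := cycL c _ _ cp cq;
      rewrite [_ + _](_ : _ = (c *: 0 + 0, c *: p + q))// addr0 scaler0.
  move=> cw'; have [_ w'U] := cycU _ cw'.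
  case: (irrU' (U' :&: N)%VS (capvSl _ _)) => [x u' _|Z0|ZU].
  - rewrite !memv_cap => /andP[u'U /NP cu']; rewrite sU' ?memvf//.
    by apply/NP; have := cyc_act x _ cu'; rewrite /a /pair_act /= (lin0 (actr x)).
  - by apply/eqP; rewrite -memv0 -Z0 memv_cap w'U; apply/NP.
  - move: wU; rewrite -ZU memv_cap => /andP[_ /NP cw].
    have [||c [/esym/eqP cv wE]] := cyc_top _ cw.
    + by apply: contra w0 => /eqP[->].
    + by rewrite /a /pair_act /= (lin0 (actr _)) ww -[in LHS](scaler0 _ (lambda H)).
    + by move: cv; rewrite scaler_eq0 (negPf v0) orbF => /eqP c0; rewrite wE c0 scale0r eqxx in w0.
have inj2 v' : cyc (v', 0) -> v' = 0.
  have [|N NP] := @exists_vspace F V (fun u => cyc (u, 0)) cyc0.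
    by move=> c p q cp cq; have := cycL c _ _ cp cq;
      rewrite [_ + _](_ : _ = (c *: p + q, c *: 0 + 0))// addr0 scaler0.
  move=> cv'; have [v'U _] := cycU _ cv'.
  case: (irrU (U :&: N)%VS (capvSl _ _)) => [x u' _|Z0|ZU].
  - rewrite !memv_cap => /andP[u'U /NP cu']; rewrite sU ?memvf//.
    by apply/NP; have := cyc_act x _ cu'; rewrite /a /pair_act /= (lin0 (actr' x)).
  - by apply/eqP; rewrite -memv0 -Z0 memv_cap v'U; apply/NP.
  - move: vU; rewrite -ZU memv_cap => /andP[_ /NP cv].
    have [||c [vE /esym/eqP cw]] := cyc_top _ cv.
    + by apply: contra v0 => /eqP[->].
    + by rewrite /a /pair_act /= (lin0 (actr' _)) vw -[in LHS](scaler0 _ (lambda H)).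
    + by move: cw; rewrite scaler_eq0 (negPf w0) orbF => /eqP c0; rewrite vE c0 scale0r eqxx in v0.
(* The first components form a submodule of [U] containing [v], hence all of [U]. *)
have surj1 u : u \in U -> exists w', cyc (u, w').
  have [||N NP] := @exists_vspace F V (fun u => exists w', cyc (u, w')).
  - by exists 0.
  - by move=> c u1 u2 [w1 c1] [w2 c2]; exists (c *: w1 + w2); exact: (cycL c _ _ c1 c2).
  case: (irrU (U :&: N)%VS (capvSl _ _)) => [x u' _|Z0|<-].
  - rewrite !memv_cap => /andP[u'U /NP[w' cw']]; rewrite sU ?memvf//.
    by apply/NP; exists (act' x w'); exact: (cyc_act x _ cw').
  - case/negP: v0; rewrite -memv0 -Z0 memv_cap vU; apply/NP; exists w; exact: cyclic_gen.
  - by rewrite memv_cap => /andP[_ /NP].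
have surj2 u : u \in U' -> exists v', cyc (v', u).
  have [||N NP] := @exists_vspace F W (fun u => exists v', cyc (v', u)).
  - by exists 0.
  - by move=> c u1 u2 [w1 c1] [w2 c2]; exists (c *: w1 + w2); exact: (cycL c _ _ c1 c2).
  case: (irrU' (U' :&: N)%VS (capvSl _ _)) => [x u' _|Z0|<-].
  - rewrite !memv_cap => /andP[u'U /NP[w' cw']]; rewrite sU' ?memvf//.
    by apply/NP; exists (act x w'); exact: (cyc_act x _ cw').
  - case/negP: w0; rewrite -memv0 -Z0 memv_cap wU; apply/NP; exists v; exact: cyclic_gen.
  - by rewrite memv_cap => /andP[_ /NP].
have [M MP] := exists_vspace cyc0 cycL.
pose p1 : 'Hom((V * W)%type, V) := linfun fst; pose p2 : 'Hom((V * W)%type, W) := linfun snd.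
have p1E p : p1 p = p.1 by rewrite linear_lfunE.
have p2E p : p2 p = p.2 by rewrite linear_lfunE.
(* The graph [M] becomes a linear map through a pseudo-inverse of its projection to [V]. *)
pose q := (p1 \o projv M)%VF.
pose phi := (p2 \o (projv M \o q^-1))%VF.
have phiP u : u \in U -> cyc (u, phi u).
  move=> /surj1[w' /MP cuw].
  have qu : q (u, w') = u by rewrite comp_lfunE projv_id// p1E.
  have : q (q^-1%VF u) = u by rewrite limg_lfunVK// -[X in X \in _]qu memv_img ?memvf.
  rewrite comp_lfunE p1E => e; apply/MP; rewrite !comp_lfunE p2E.
  by rewrite -[X in (X, _)]e -surjective_pairing memv_proj.
have cycB p q' : cyc p -> cyc q' -> cyc (p - q').
  by move=> cp cq; rewrite addrC -scaleN1r; exact: cycL.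
exists phi; split.
- apply/vspaceP => w'; apply/memv_imgP/idP => [[u /phiP/cycU[_ ?] ->//]|w'U].
  have [u cu] := surj2 _ w'U; have [uU _] := cycU _ cu.
  exists u => //; apply/eqP; rewrite -subr_eq0; apply/eqP/inj1.
  by have := cycB _ _ cu (phiP _ uU); rewrite [_ - _](_ : _ = (u - u, w' - phi u))// subrr.
- by move=> u /phiP + e; rewrite e => /inj2.
- move=> x u uU; apply/eqP; rewrite -subr_eq0; apply/eqP/inj1.
  have := cycB _ _ (phiP _ (sU x u (memvf _) uU)) (cyc_act x _ (phiP _ uU)).
  by rewrite [_ - _](_ : _ = (act x u - act x u, phi (act x u) - act' x (phi u)))// subrr.
Qed.

End HighestWeightUnique.

(** * Highest weights of irreducible gl_n-modules *)

Section GlHighestWeight.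
Variables (F : numClosedFieldType) (n : nat).

Lemma gl_br_linr (A : 'M[F]_n) : linear (gl_br A).
Proof.
move=> a B C; rewrite /gl_br mulmxDr mulmxDl -scalemxAr -scalemxAl opprD addrACA.
by rewrite -scalerBr.
Qed.

Let E (i j : 'I_n) : 'M[F]_n := delta_mx i j.

(** With diagonal entries [- i], bracketing multiplies [E i j] by [j - i], which is negative below
    the diagonal. This matrix plays the role of [H] above. *)
Let height : 'M[F]_n := diag_mx (\row_i (- i%:R)).

Let height_br i j : gl_br height (E i j) = (j%:R - i%:R) *: E i j.
Proof.
rewrite /gl_br /height; apply/matrixP => p q.
rewrite mul_diag_mx mul_mx_diag !mxE.
case: eqP => [->|]; case: eqP => [->|] => //=;
  by rewrite ?(mulr1, mulr0, mul1r, mul0r, subrr) ?opprK// addrC.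
Qed.

Variables (V : vectType F) (act : 'M[F]_n -> V -> V) (c : F).
Hypotheses (actP : lie_module (@gl_br F n) act) (act1 : forall v, act 1%:M v = c *: v).
Hypothesis irr : irreducible act fullv fullv.

Let acl u : linear (act^~ u). Proof. by case: actP. Qed.

(** [E i i] is [1/n] times the sum of the identity, which acts by [c], and of the differences
    [E i i - E j j], on which [psi] gives the action. *)
Lemma gl_diag_weight (psi : dual (sl_cartan F n)) v i : weight_vector act psi v ->
  exists d, act (E i i) v = d *: v.
Proof.
move=> vw.
have n0 : (n%:R : F) != 0 by rewrite pnatr_eq0 -lt0n (leq_ltn_trans _ (ltn_ord i)).
have Eij j : exists d, act (E i i - E j j) v = d *: v.
  have h : E i i - E j j \in sl_cartan F n.
    by apply: memv_span; apply: allpairs_f; rewrite mem_enum.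
  by exists (psi (vsproj _ (E i i - E j j))); rewrite -vw vsprojK.
have [d dE] := choice Eij.
have -> : E i i = n%:R^-1 *: (1%:M + \sum_j (E i i - E j j)).
  rewrite sumrB sumr_const card_ord addrCA.
  have <- : 1%:M = \sum_j E j j :> 'M[F]_n.
    apply/matrixP => p q; rewrite summxE mxE (bigD1 p)//= !mxE eqxx eq_sym.
    by rewrite big1 ?addr0// => k /negPf kp; rewrite mxE eq_sym kp.
  by rewrite subrr addr0 -[E i i *+ n]scaler_nat scalerA mulVf ?scale1r.
exists (n%:R^-1 * (c + \sum_j d j)).
rewrite (linZ (acl _)) (linD (acl _)) act1 (lin_sum (acl _)).
by under eq_bigr do rewrite dE; rewrite -scaler_suml -scalerDl scalerA.
Qed.

Let neg f := exists (i j : 'I_n) (a : F), (j < i)%N /\ f = a *: E i j.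

Let negP f : neg f -> exists q : nat, gl_br height f = - q.+1%:R *: f.
Proof.
move=> [i [j [a [ji ->]]]]; exists (i - j).-1; rewrite prednK ?subn_gt0//.
rewrite (linZ (gl_br_linr _)) height_br natrB 1?ltnW// opprB !scalerA.
by rewrite mulrC.
Qed.

Let borel_neg (psi : dual (sl_cartan F n)) v : weight_vector act psi v ->
  (forall i j : 'I_n, (i < j)%N -> act (delta_mx i j) v = 0) ->
  forall P : 'M[F]_n -> Prop, (forall x y, P x -> P y -> P (x + y)) ->
  (forall x c, act x v = c *: v -> P x) -> (forall f, neg f -> P f) -> forall x, P x.
Proof.
move=> vw vp P PD Pb Pn x; rewrite [x]matrix_sum_delta.
have P0 : P 0 by apply: (Pb _ 0); rewrite scale0r (lin0 (acl v)).
apply: (big_ind P) => // i _; apply: (big_ind P) => // j _.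
case: (ltngtP i j) => [ij|ji|/val_inj ij].
- by apply: (Pb _ 0); rewrite (linZ (acl v)) vp// scaler0 scale0r.
- by apply: Pn; exists i, j, (x i j).
- have [d dE] := gl_diag_weight i vw.
  by apply: (Pb _ (x i j * d)); rewrite -ij (linZ (acl v)) dE scalerA.
Qed.

Let height_weight (psi : dual (sl_cartan F n)) v : weight_vector act psi v ->
  exists l, act height v = l *: v.
Proof.
move=> vw; have [d dE] := choice (fun i => gl_diag_weight i vw).
exists (\sum_(i < n) (- i%:R) * d i).
have -> : height = \sum_(i < n) (- i%:R) *: E i i.
  apply/matrixP => p q; rewrite summxE (bigD1 p)//= !mxE eqxx big1 ?addr0.
    by rewrite eq_sym; case: eqP; rewrite ?mulr1 ?mulr0.
  by move=> k /negPf kp; rewrite !mxE eq_sym kp mulr0.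
rewrite (lin_sum (acl v)) scaler_suml; apply: eq_bigr => i _.
by rewrite (linZ (acl v)) dE scalerA.
Qed.

(** By irreducibility the cyclic submodule of [v] is all of [V], so every eigenvector of [height]
    can be compared with [v]. *)
Let compare_heights (psi : dual (sl_cartan F n)) v v' l l' :
  v != 0 -> weight_vector act psi v ->
  (forall i j : 'I_n, (i < j)%N -> act (delta_mx i j) v = 0) ->
  act height v = l *: v -> v' != 0 -> act height v' = l' *: v' ->
  (l' = l /\ exists c, v' = c *: v) \/ exists j : nat, l' = l - j.+1%:R.
Proof.
move=> v0 vw vp vl v'0 v'l.
apply: (cyclic_eigenvector actP vl (@negP) _ v'0 v'l).
have [||M MP] := @exists_vspace F V (cyclic act v neg).
- exact: cyclic0.
- by move=> *; exact: cyclic_lin.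
apply/MP; case: irr => _ _ irr'; case: (irr' M (subvf _)) => [x u _ /MP cu|M0|->].
- by apply/MP; apply: (cyclic_act actP) => //; exact: borel_neg vw vp.
- by case/eqP: v0; apply/eqP; rewrite -memv0 -M0; apply/MP; exact: cyclic_gen.
- exact: memvf.
Qed.

(** Each of the two vectors generates [V]. If they were not proportional, each height eigenvalue
    would lie below the other by a positive integer. *)
Lemma gl_highest_weight_unique (psi psi' : dual (sl_cartan F n)) v v' :
  v != 0 -> weight_vector act psi v ->
  (forall i j : 'I_n, (i < j)%N -> act (delta_mx i j) v = 0) ->
  v' != 0 -> weight_vector act psi' v' ->
  (forall i j : 'I_n, (i < j)%N -> act (delta_mx i j) v' = 0) -> psi = psi'.
Proof.
move=> v0 vw vp v'0 v'w v'p.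
have [l vl] := height_weight vw; have [l' v'l] := height_weight v'w.
have shiftF (a : F) j k : a = a - j.+1%:R - k%:R -> False.
  rewrite -addrA -opprD -natrD -[LHS]subr0 => /addrI/oppr_inj/esym/eqP.
  by rewrite pnatr_eq0.
case: (compare_heights v0 vw vp vl v'0 v'l) => [[_ [a aE]]|[j jE]].
  apply/lfunP => y; apply/eqP; rewrite -subr_eq0.
  have : (psi y - psi' y) *: v' = 0.
    rewrite scalerBl -v'w {1}aE scalerA mulrC -scalerA -vw.
    by case: actP => actr _ _; rewrite -(linZ (actr _)) -aE subrr.
  by move/eqP; rewrite scaler_eq0 (negPf v'0) orbF.
case: (compare_heights v'0 v'w v'p v'l v0 vl) => [[lE _]|[k kE]].
  by case: (@shiftF l j 0%N); rewrite subr0 -jE.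
by case: (@shiftF l j k.+1); rewrite -jE.
Qed.

End GlHighestWeight.

(** * The grading of g and twists by characters *)

Section Eigenspaces.
Variables (F : numClosedFieldType) (g : vectType F) (br : g -> g -> g).
Variables (n : nat) (sigma : 'I_n -> 'End(g)) (m : 'I_n -> nat) (xi : 'I_n -> F).
Hypothesis sigma_aut : commuting_automorphisms br sigma m.
Hypothesis xi_prim : forall i, (m i).-primitive_root (xi i).

Local Notation eig := (eig sigma xi).

Lemma memv_eig k x : (x \in eig k) <-> forall i, sigma i x = xi i ^ k 0 i *: x.
Proof.
rewrite /Defs.eig (big_morph (fun U : {vspace g} => x \in U) (memv_cap x) (memvf x)) big_andE.
split=> [/forallP xk i|xk].
  by have := xk i; rewrite memv_ker shift_lfunE subr_eq0 => /eqP.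
by apply/forallP => i; rewrite memv_ker shift_lfunE xk subrr eqxx.
Qed.

Let xi0 i : xi i != 0.
Proof. by rewrite (prim_root_eq0 (xi_prim i)) -lt0n (prim_order_gt0 (xi_prim i)). Qed.

Lemma eig_br k l x y : x \in eig k -> y \in eig l ->
  lie_algebra br -> br x y \in eig (k + l).
Proof.
move=> /memv_eig xk /memv_eig yl g_lie; apply/memv_eig => i.
have [/(_ i)[_ ->] _ _] := sigma_aut.
rewrite xk yl (linZ (lie_linl g_lie _)) (linZ (lie_linr g_lie _)) scalerA.
by rewrite mxE expfzDr.
Qed.

Lemma eig_Gamma k r : r \in Gamma m -> eig (k + r) = eig k.
Proof.
move=> /forallP rG; apply/vspaceP => x; apply/idP/idP => /memv_eig xk; apply/memv_eig => i;
  have /dvdzP[q qE] := rG i; rewrite xk !mxE qE mulrC expfzDr// -exprz_exp -exprnP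
    (prim_expr_order (xi_prim i)) exp1rz mulr1//.
Qed.

(** The projection onto the eigenspace of [sigma i] for [xi i ^+ a], obtained by averaging over the
    powers of [sigma i]. *)
Let projection i a x := (m i)%:R^-1 *: \sum_(j < m i) (xi i ^+ (a * j))^-1 *: iter j (sigma i) x.

Let projection_eig i a x : sigma i (projection i a x) = xi i ^+ a *: projection i a x.
Proof.
have [_ _ /(_ i)[m0 sm _]] := sigma_aut; rewrite /projection.
rewrite linearZ /= linear_sum /= scalerA mulrC -scalerA; congr (_ *: _).
rewrite scaler_sumr; case mE: (m i) => [|d]; first by rewrite !big_ord0.
(* Applying [sigma i] shifts the sum by one place; the last term becomes the first one since the
   m_i-th powers of [sigma i] and [xi i] are trivial. *)
rewrite big_ord_recr [RHS]big_ord_recl /= addrC; congr (_ + _).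
  rewrite muln0 expr0 invr1 linearZ /= -iterS -mE sm scalerA mulr1; congr (_ *: _).
  apply: (mulIf (expf_neq0 (a * d) (xi0 i))); rewrite mulVf ?expf_neq0// -exprD -mulnS.
  by rewrite -mE mulnC exprM (prim_expr_order (xi_prim i)) expr1n.
apply: eq_bigr => j _; rewrite linearZ /= scalerA mulnS exprD invfM; congr (_ *: _).
by rewrite mulVKf// expf_neq0.
Qed.

(** After exchanging the sums, the coefficient of the j-th iterate is a geometric sum of powers of
    the root of unity [(xi i)^-1 ^+ j], which vanishes unless [j = 0]. *)
Let projection_sum i x : \sum_(a < m i) projection i a x = x.
Proof.
have m0 : (m i)%:R != 0 :> F by rewrite pnatr_eq0 -lt0n (prim_order_gt0 (xi_prim i)).
rewrite /projection -scaler_sumr exchange_big /=.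
apply: (scalerI m0); rewrite scalerA mulfV// scale1r.
have := prim_order_gt0 (xi_prim i); case mE: (m i) => [//|d] _; rewrite [LHS]big_ord_recl /=.
rewrite [X in _ + X]big1 ?addr0 => [|j _]; last first.
  rewrite -scaler_suml; set z := (xi i)^-1 ^+ j.+1.
  have z1 : z - 1 != 0.
    rewrite subr_eq0 /z exprVn invr_eq1 -(prim_order_dvd (xi_prim i)) gtnNdvd//.
    by rewrite mE ltnS.
  rewrite (eq_bigr (fun a : 'I_d.+1 => z ^+ a)) => [|a _]; last first.
    by rewrite /z !exprVn -exprM mulnC.
  apply/eqP; rewrite scaler_eq0; apply/orP; left; apply/eqP/(mulfI z1).
  by rewrite -subrX1 mulr0 /z exprAC exprVn -mE (prim_expr_order (xi_prim i)) invr1 expr1n subrr.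
under eq_bigr do rewrite muln0 expr0 invr1 scale1r.
by rewrite sumr_const card_ord scaler_nat.
Qed.

(** The automorphisms are diagonalised one at a time: an eigenvector of all [sigma i] with [i > s]
    is split by the projections of [sigma s], which preserve the other eigenvector conditions as the
    automorphisms commute. *)
Lemma eig_ind (P : g -> Prop) : (forall x y, P x -> P y -> P (x + y)) ->
  (forall k x, x \in eig k -> P x) -> forall x, P x.
Proof.
move=> PD Pe.
have P0 : P 0 by apply: (Pe 0); exact: mem0v.
suff H s : (s <= n)%N -> forall k x, (forall i : 'I_n, (s <= i)%N ->
    sigma i x = xi i ^ (k : 'rV[int]_n) 0 i *: x) -> P x.
  by move=> x; apply: (H n (leqnn n) 0) => i; rewrite leqNgt ltn_ord.
elim: s => [|s IH] sn k x xk; first by apply: (Pe k); apply/memv_eig => i; exact: xk.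
pose i0 := Ordinal sn; rewrite -(projection_sum i0 x).
apply: big_ind => // a _; apply: (IH (ltnW sn) (\row_i if i == i0 then a%:Z else k 0 i)) => i.
rewrite mxE; case: eqP => [-> _|ii0 si]; first exact: projection_eig.
rewrite /projection linearZ /= linear_sum /= scalerA mulrC -scalerA; congr (_ *: _).
rewrite scaler_sumr; apply: eq_bigr => j _.
rewrite linearZ /= scalerA mulrC -scalerA; congr (_ *: _).
have [_ sC _] := sigma_aut.
rewrite -[LHS]/(sigma i _) (_ : sigma i (iter j _ _) = iter j (sigma i0) (sigma i x)).
  rewrite xk; last by rewrite ltn_neqAle si andbT; apply/eqP => e; apply: ii0; exact/val_inj.
  have [s' s'E] := exists_iter_lfun (sigma i0) j.
  by rewrite -!s'E linearZ.
by apply: (@iter_swap _ (sigma i) (sigma i0) 1) => u; exact: sC.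
Qed.

End Eigenspaces.

Section Bar.
Variables (n : nat) (m : 'I_n -> nat).

Lemma barD k l : bar m (k + l) = bar m k + bar m l.
Proof. exact: raddfD. Qed.

Lemma bar_Gamma k r : r \in Gamma m -> bar m (k + r) = bar m k.
Proof.
move=> rG; apply/eqP; rewrite /bar -Quotient.idealrBE.
by rewrite addrC addrA addNr add0r.
Qed.

Lemma bar_eq k l : bar m k = bar m l -> k - l \in Gamma m.
Proof. by move/eqP; rewrite /bar -Quotient.idealrBE. Qed.

Lemma bar_repr (a : grG m) : exists k, bar m k = a.
Proof. by exists (repr a); exact: reprK. Qed.

End Bar.

Section Twists.
Variables (F : numClosedFieldType) (g : vectType F) (br : g -> g -> g).
Variables (form : g -> g -> F) (h : {vspace g}) (Pi : seq (dual h)).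
Variables (n : nat) (sigma : 'I_n -> 'End(g)) (m : 'I_n -> nat) (xi : 'I_n -> F).
Hypotheses (g_lie : lie_algebra br) (h_cartan : cartan_subalgebra br fullv h).
Hypotheses (Pi_simple : simple_roots br fullv Pi) (form_inv : invariant_form br form).
Hypothesis sigma_aut : commuting_automorphisms br sigma m.
Hypothesis xi_prim : forall i, (m i).-primitive_root (xi i).

Local Notation eig := (eig sigma xi).
Local Notation orbit := (char_orbit br Pi sigma m xi).

Definition twist (alpha : 'End(g)) := exists chi : grG m -> F,
  is_character chi /\ forall k x, x \in eig k -> alpha x = chi (bar m k) *: x.

Let chi_neq0 (chi : grG m -> F) a : is_character chi -> chi a != 0.
Proof.
move=> [chi0 chiD]; apply/eqP => e; have := chiD a (- a).
by rewrite subrr chi0 e mul0r => /eqP; rewrite oner_eq0.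
Qed.

(** Characters have non-zero values, so the image contains all graded components and [alpha] is
    surjective; a dimension count gives injectivity. *)
Lemma twist_bij alpha : twist alpha -> lker alpha = 0%VS.
Proof.
move=> [chi [chiP alE]].
have full : limg alpha = fullv.
  apply/vspaceP => x; rewrite memvf.
  apply: (eig_ind sigma_aut xi_prim (P := fun x => x \in limg alpha)) x.
    by move=> x y; exact: memvD.
  move=> k x xk; apply/memv_imgP; exists ((chi (bar m k))^-1 *: x); rewrite ?memvf//.
  by rewrite linearZ /= (alE _ _ xk) scalerA mulVf ?scale1r ?chi_neq0.
have := limg_ker_dim alpha fullv; rewrite full capfv => /eqP.
by rewrite -[X in _ == X]add0n eqn_add2r dimv_eq0 => /eqP.
Qed.

Lemma twist_inv alpha : twist alpha ->
  exists beta, [/\ twist beta, cancel alpha beta & cancel beta alpha].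
Proof.
move=> al; have /eqP k0 := twist_bij al; case: al => chi [chiP alE].
exists (alpha^-1)%VF; split; last exact: lker0_lfunVK.
  exists (fun a => chi (- a)); split.
    case: (chiP) => chi0 chiD; split=> [|a b]; first by rewrite oppr0.
    by rewrite opprD chiD.
  move=> k x xk; have /lker0P inj := k0; apply: inj; rewrite lker0_lfunVK// linearZ /= (alE _ _ xk).
  by case: chiP => chi0 chiD; rewrite scalerA -chiD addNr chi0 scale1r.
exact: lker0_lfunK.
Qed.

Lemma twist_comp alpha beta : twist alpha -> twist beta -> twist (alpha \o beta)%VF.
Proof.
move=> [chi [[chi0 chiD] alE]] [chi' [[chi'0 chi'D] beE]].
exists (fun a => chi a * chi' a); split.
  by split=> [|a b]; rewrite ?chi0 ?chi'0 ?mulr1// chiD chi'D mulrACA.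
move=> k x xk; rewrite comp_lfunE (beE _ _ xk) linearZ /= (alE _ _ xk) scalerA.
by rewrite mulrC.
Qed.

Lemma twist_br alpha x y : twist alpha -> alpha (br x y) = br (alpha x) (alpha y).
Proof.
move=> [chi [[_ chiD] alE]].
have brl := lie_linl g_lie; have brr := lie_linr g_lie.
apply: (eig_ind sigma_aut xi_prim (P := fun x => alpha (br x y) = br (alpha x) (alpha y))) x.
  by move=> x x' e e'; rewrite (linD (brl _)) !linearD /= e e' (linD (brl _)).
move=> k x xk.
apply: (eig_ind sigma_aut xi_prim (P := fun y => alpha (br x y) = br (alpha x) (alpha y))) y.
  by move=> y y' e e'; rewrite (linD (brr _)) !linearD /= e e' (linD (brr _)).
move=> l y yl; rewrite (alE _ _ xk) (alE _ _ yl) (linZ (brl _)) (linZ (brr _)) scalerA.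
by rewrite (alE _ _ (eig_br sigma_aut xi_prim xk yl g_lie)) barD chiD.
Qed.

Lemma twist_module alpha (V : vectType F) (act : g -> V -> V) : twist alpha ->
  lie_module br act -> lie_module br (fun x => act (alpha x)).
Proof.
move=> al [actr actl actb]; split=> [x|v a x y|x y v]; first exact: actr.
  by rewrite linearP (actl v).
by rewrite twist_br// actb.
Qed.

Let irr_hw_uniq := irr_hw_unique g_lie h_cartan Pi_simple form_inv.

(** By uniqueness [U] and [U'] are twists of V(lambda) and V(lambda'). Undoing the first twist along
    the isomorphism makes V(lambda) a twist of V(lambda'). *)
Lemma char_orbit_iso (lambda lambda' mu mu' : dual h) (V V' : vectType F)
    (act : g -> V -> V) (act' : g -> V' -> V') (U : {vspace V}) (U' : {vspace V'}) :
  lie_module br act -> lie_module br act' ->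
  orbit lambda mu -> is_irr_hw br Pi mu act U ->
  orbit lambda' mu' -> is_irr_hw br Pi mu' act' U' ->
  iso_on act U act' U' -> orbit lambda' lambda.
Proof.
move=> actP act'P [chi [al [W [a [chiP alE aP aW aaW]]]]] aU.
move=> [chi' [al' [W' [a' [chi'P al'E a'P a'W a'aW]]]]] a'U UU'.
have tal : twist al by exists chi.
have tal' : twist al' by exists chi'.
have [be [tbe alK beK]] := twist_inv tal.
have i1 : iso_on (fun x => a (al x)) fullv act U.
  by apply: irr_hw_uniq aaW aU => //; exact: twist_module.
have i2 : iso_on act' U' (fun x => a' (al' x)) fullv.
  by apply: irr_hw_uniq a'U a'aW => //; exact: twist_module.
have i3 := iso_on_twist be (iso_on_trans i1 (iso_on_trans UU' i2)).
have [ga [gaP gaE]] := twist_comp tal' tbe.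
exists ga, (al' \o be)%VF, W', a'; split=> //.
have e1 : (fun x => a (al (be x))) = a by apply/funext => x; rewrite beK.
have e2 : (fun x => a' (al' (be x))) = (fun x => a' ((al' \o be)%VF x)).
  by apply/funext => x; rewrite comp_lfunE.
rewrite -e2; apply: iso_on_irr_hw i3 _; last by rewrite e1.
by move=> x; case: a'P.
Qed.

(** The two memberships may come with different modules of highest weight [lambda]; uniqueness
    identifies them, and then the twists compose. *)
Lemma char_orbit_trans (lambda lambda' mu : dual h) :
  orbit lambda' lambda -> orbit lambda mu -> orbit lambda' mu.
Proof.
move=> [chi' [al' [W' [a' [chi'P al'E a'P a'W a'aW]]]]].
move=> [chi [al [W [a [chiP alE aP aW aaW]]]]].
have tal : twist al by exists chi.
have tal' : twist al' by exists chi'.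
have i1 : iso_on a fullv (fun x => a' (al' x)) fullv.
  by apply: irr_hw_uniq aW a'aW => //; exact: twist_module.
have i2 := iso_on_twist al i1.
have [ga [gaP gaE]] := twist_comp tal' tal.
exists ga, (al' \o al)%VF, W', a'; split=> //.
have e2 : (fun x => a' (al' (al x))) = (fun x => a' ((al' \o al)%VF x)).
  by apply/funext => x; rewrite comp_lfunE.
rewrite -e2; apply: iso_on_irr_hw i2 aaW.
by move=> x; case: a'P.
Qed.

(** Twists are bijective on [g], so V(lambda) is trivial as soon as one of its twists is, and then
    its highest weight is 0. *)
Lemma char_orbit_trivial (lambda mu : dual h) (V : vectType F) (act : g -> V -> V)
    (U : {vspace V}) :
  lie_module br act -> orbit lambda mu -> is_irr_hw br Pi mu act U ->
  (forall x u, u \in U -> act x u = 0) -> lambda = 0.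
Proof.
move=> actP [chi [al [W [a [chiP alE aP aW aaW]]]]] aU triv.
have tal : twist al by exists chi.
have [be [_ _ beK]] := twist_inv tal.
have [phi [phiU phi0 phiE]] : iso_on (fun x => a (al x)) fullv act U.
  by apply: irr_hw_uniq aaW aU => //; exact: twist_module.
case: aW => _ [v [_ v0 vw _]]; apply/lfunP => y; rewrite lfunE.
have : lambda y *: v = 0.
  rewrite -vw -[vsval y]beK; apply: phi0; rewrite ?memvf// phiE ?memvf// triv//.
  by rewrite -phiU memv_img ?memvf.
by move/eqP; rewrite scaler_eq0 (negPf v0) orbF => /eqP.
Qed.

(** [orbit_sum] refers to [lambda] through its orbit only. *)
Lemma schur_index_orbit (lambda lambda' : dual h) :
  orbit lambda = orbit lambda' ->
  schur_index br Pi sigma m xi lambda = schur_index br Pi sigma m xi lambda'.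
Proof. by rewrite /schur_index /orbit_sum => ->. Qed.

End Twists.

(** * Tensor products and convolutions *)

Section Tensor.
Variables (F : numClosedFieldType) (V1 V2 : vectType F).
Local Notation b1 := (vbasis {:V1}).
Local Notation b2 := (vbasis {:V2}).

Lemma pure_linl v2 : linear ((@pure F V1 V2)^~ v2).
Proof. by move=> a u v; apply/matrixP => i j; rewrite !mxE linearP mulrDl mulrA. Qed.

Lemma pure_linr v1 : linear (@pure F V1 V2 v1).
Proof. by move=> a u v; apply/matrixP => i j; rewrite !mxE linearP mulrDr mulrCA. Qed.

Lemma tens_map_lin f1 f2 : linear (@tens_map F V1 V2 f1 f2).
Proof.
move=> a w w'; rewrite /tens_map scaler_sumr -big_split; apply: eq_bigr => i _.
rewrite scaler_sumr -big_split; apply: eq_bigr => j _ /=.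
by rewrite !mxE scalerDl scalerA.
Qed.

Lemma tens_map_pure (f1 : V1 -> V1) (f2 : V2 -> V2) v1 v2 : linear f1 -> linear f2 ->
  tens_map f1 f2 (pure v1 v2) = pure (f1 v1) (f2 v2).
Proof.
move=> l1 l2; rewrite [in RHS](coord_vbasis (memvf v1)) [in RHS](coord_vbasis (memvf v2)).
rewrite (lin_sum l1) (lin_sum l2) (lin_sum (pure_linl _)); apply: eq_bigr => i _.
rewrite (lin_sum (pure_linr _)); apply: eq_bigr => j _.
by rewrite (linZ l1) (linZ l2) (linZ (pure_linl _)) (linZ (pure_linr _)) mxE scalerA.
Qed.

Lemma mem_pure (U1 : {vspace V1}) (U2 : {vspace V2}) u1 u2 :
  u1 \in U1 -> u2 \in U2 -> pure u1 u2 \in tens_sub U1 U2.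
Proof.
move=> u1U u2U; rewrite (coord_vbasis u1U) (coord_vbasis u2U) (lin_sum (pure_linl _)).
apply: memv_suml => i _; rewrite (lin_sum (pure_linr _)); apply: memv_suml => j _.
rewrite (linZ (pure_linl _)) (linZ (pure_linr _)) !memvZ//; apply: memv_span.
by apply: allpairs_f; rewrite mem_nth ?size_tuple.
Qed.

Lemma tens_sub_ind (U1 : {vspace V1}) (U2 : {vspace V2}) (P : tens V1 V2 -> Prop) :
  P 0 -> (forall a u v, P u -> P v -> P (a *: u + v)) ->
  (forall u1 u2, u1 \in U1 -> u2 \in U2 -> P (pure u1 u2)) ->
  forall w, w \in tens_sub U1 U2 -> P w.
Proof.
move=> P0 PD Pp w wU; have [Z ZP] := exists_vspace P0 PD; apply/ZP.
apply: subvP w wU; apply/span_subvP => _ /allpairsP[[u1 u2] /= [u1U u2U ->]].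
by apply/ZP/Pp; exact: vbasis_mem.
Qed.

Lemma tens_map_sub (U1 U1' : {vspace V1}) (U2 U2' : {vspace V2}) (f1 : V1 -> V1) (f2 : V2 -> V2) w :
  linear f1 -> linear f2 -> (forall u, u \in U1 -> f1 u \in U1') ->
  (forall u, u \in U2 -> f2 u \in U2') ->
  w \in tens_sub U1 U2 -> tens_map f1 f2 w \in tens_sub U1' U2'.
Proof.
move=> l1 l2 f1U f2U; move: w; apply: tens_sub_ind => [|a u v|u1 u2 u1U u2U].
- by rewrite (lin0 (tens_map_lin _ _)) mem0v.
- by move=> ? ?; rewrite tens_map_lin memvD ?memvZ.
- by rewrite tens_map_pure//; apply: mem_pure; [exact: f1U|exact: f2U].
Qed.

(** Contraction of one tensor factor with a coordinate form of its basis. It turns maps into a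
    tensor product into maps into a single factor. *)
Definition row_slice i (w : tens V1 V2) : V2 := \sum_j w i j *: b2`_j.
Definition col_slice j (w : tens V1 V2) : V1 := \sum_i w i j *: b1`_i.

Lemma row_slice_lin i : linear (row_slice i).
Proof.
move=> a u v; rewrite /row_slice scaler_sumr -big_split; apply: eq_bigr => j _ /=.
by rewrite !mxE scalerDl scalerA.
Qed.

Lemma col_slice_lin j : linear (col_slice j).
Proof.
move=> a u v; rewrite /col_slice scaler_sumr -big_split; apply: eq_bigr => i _ /=.
by rewrite !mxE scalerDl scalerA.
Qed.

Lemma row_slice_pure i v1 v2 : row_slice i (pure v1 v2) = coord b1 i v1 *: v2.
Proof.
rewrite [in RHS](coord_vbasis (memvf v2)) scaler_sumr; apply: eq_bigr => j _.
by rewrite mxE scalerA.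
Qed.

Lemma col_slice_pure j v1 v2 : col_slice j (pure v1 v2) = coord b2 j v2 *: v1.
Proof.
rewrite [in RHS](coord_vbasis (memvf v1)) scaler_sumr; apply: eq_bigr => i _.
by rewrite mxE scalerA mulrC.
Qed.

Lemma row_slice_map i (f : V2 -> V2) w : linear f ->
  row_slice i (tens_map id f w) = f (row_slice i w).
Proof.
move=> fL; rewrite /tens_map (lin_sum (row_slice_lin i)) (bigD1 i)//= [X in _ + X]big1 ?addr0.
  rewrite (lin_sum (row_slice_lin i)) /row_slice (lin_sum fL); apply: eq_bigr => j _.
  rewrite -/(row_slice i _) (linZ (row_slice_lin i)) row_slice_pure.
  by rewrite coord_free ?(basis_free (vbasisP _))// eqxx scale1r (linZ fL).
move=> k /negPf ki; rewrite (lin_sum (row_slice_lin i)) big1// => j _.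
rewrite (linZ (row_slice_lin i)) row_slice_pure.
by rewrite coord_free ?(basis_free (vbasisP _))// ki scale0r scaler0.
Qed.

Lemma col_slice_map j (f : V1 -> V1) w : linear f ->
  col_slice j (tens_map f id w) = f (col_slice j w).
Proof.
move=> fL; rewrite /tens_map exchange_big /=.
rewrite (lin_sum (col_slice_lin j)) (bigD1 j)//= [X in _ + X]big1 ?addr0.
  rewrite (lin_sum (col_slice_lin j)) /col_slice (lin_sum fL); apply: eq_bigr => i _.
  rewrite -/(col_slice j _) (linZ (col_slice_lin j)) col_slice_pure.
  by rewrite coord_free ?(basis_free (vbasisP _))// eqxx scale1r (linZ fL).
move=> k /negPf ki; rewrite (lin_sum (col_slice_lin j)) big1// => i _.
rewrite (linZ (col_slice_lin j)) col_slice_pure.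
by rewrite coord_free ?(basis_free (vbasisP _))// ki scale0r scaler0.
Qed.

Lemma exists_row_slice w : w != 0 -> exists i, row_slice i w != 0.
Proof.
move=> w0; apply: contrapT => nw; case/eqP: w0; apply/matrixP => i j; rewrite mxE.
have : row_slice i w = 0 by apply: contrapT => /eqP ?; apply: nw; exists i.
by move/freeP: (basis_free (vbasisP {:V2})) => /(_ (w i)) H /H.
Qed.

Lemma exists_col_slice w : w != 0 -> exists j, col_slice j w != 0.
Proof.
move=> w0; apply: contrapT => nw; case/eqP: w0; apply/matrixP => i j; rewrite mxE.
have : col_slice j w = 0 by apply: contrapT => /eqP ?; apply: nw; exists j.
by move/freeP: (basis_free (vbasisP {:V1})) => /(_ (w^~ j)) H /H.
Qed.

Lemma pure_neq0 v1 v2 : v1 != 0 -> v2 != 0 -> pure v1 v2 != 0 :> tens V1 V2.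
Proof.
move=> v10 v20; apply/eqP => e.
case/eqP: v10; rewrite (coord_vbasis (memvf v1)) big1// => i _.
have := row_slice_pure i v1 v2; rewrite e (lin0 (row_slice_lin i)) => /esym/eqP.
by rewrite scaler_eq0 (negPf v20) orbF => /eqP ->; rewrite scale0r.
Qed.

End Tensor.

Section Conv.
Variables (F : numClosedFieldType) (n : nat).
Local Notation Zn := 'rV[int]_n.

Lemma gsum_mem (W : vectType F) (U : Zn -> {vspace W}) (f : gsum U) k : f k \in U k.
Proof. by case: f => f /= /asboolP[]. Qed.

Lemma gsum_finite (W : vectType F) (U : Zn -> {vspace W}) (f : gsum U) :
  finite_set [set k | f k != 0]%classic.
Proof. by case: f => f /= /asboolP[]. Qed.

Lemma gsumP (W : vectType F) (U : Zn -> {vspace W}) (f f' : gsum U) :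
  (forall k, f k = f' k) -> f = f'.
Proof. by move=> e; apply: val_inj; apply/funext. Qed.

Lemma monoE (W : vectType F) (U : Zn -> {vspace W}) k w j : w \in U k ->
  mono U k w j = if j == k then w else 0.
Proof.
move=> wU; rewrite /mono -[gsum_val _]/(val _) val_insubd.
case: ifP => // /negP[]; apply/asboolP; split.
  apply: (sub_finite_set _ (finite_set1 k)) => i /=.
  by case: (eqVneq i k) => //; rewrite eqxx.
by move=> i; case: eqP => [->|_] //; exact: mem0v.
Qed.

Lemma mono0 (W : vectType F) (U : Zn -> {vspace W}) k : mono U k 0 = 0.
Proof. by apply: gsumP => j; rewrite monoE ?mem0v//; case: ifP. Qed.

Lemma gsum_sum (W : vectType F) (U : Zn -> {vspace W}) (I : Type) (s : seq I) (f : I -> gsum U) j :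
  (\sum_(k <- s) f k) j = \sum_(k <- s) f k j.
Proof. by elim/big_ind2: _ => // x1 x2 y1 y2 <- <-. Qed.

Variables (W1 W2 W3 : vectType F) (U1 : Zn -> {vspace W1}) (U2 : Zn -> {vspace W2}).
Variables (U3 : Zn -> {vspace W3}) (b : Zn -> W1 -> Zn -> W2 -> W3).

Lemma conv0l (y : gsum U2) : (forall k l w, b k 0 l w = 0) -> conv U3 b (0 : gsum U1) y = 0.
Proof.
move=> b0; rewrite /conv fsbig1// => k _; rewrite fsbig1// => l _.
by rewrite b0 mono0.
Qed.

Lemma conv_mono l x (y : gsum U2) j : x \in U1 l ->
  (forall k l w, b k 0 l w = 0) -> (forall k, b l x k 0 = 0) ->
  (forall k w, w \in U2 k -> b l x k w \in U3 (l + k)) ->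
  conv U3 b (mono U1 l x) y j = b l x (j - l) (y (j - l)).
Proof.
move=> xU b0l b0r bU; rewrite /conv.
rewrite -(fsbig_widen [set l]%classic)//; last first.
  move=> k [_ /= kl]; rewrite fsbig1// => i _.
  by rewrite monoE//; case: eqP kl => // _ _; rewrite b0l mono0.
rewrite fsbig_set1 (monoE _ xU) eqxx.
(* The degree [j - l] is added to the support so that its term can be singled out even if [y]
   vanishes there. *)
pose A := ([set k | y k != 0] `|` [set j - l])%classic.
have fA : finite_set A by rewrite finite_setU; split; [exact: gsum_finite|exact: finite_set1].
rewrite -(fsbig_widen A)//; last first.
  move=> k [_ /= kA]; have -> : y k = 0 by apply: contrapT => /eqP ?; apply: kA; left.
  by rewrite b0r mono0.
rewrite fsbig_finite// gsum_sum (bigD1_seq (j - l))/=; last first.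
- exact: fset_uniq.
- by rewrite in_fset_set// inE; right.
rewrite monoE; last exact/bU/gsum_mem.
rewrite [l + _]addrC subrK eqxx big1 ?addr0// => k kj.
rewrite monoE; last exact/bU/gsum_mem.
by case: eqP => // e; move: kj; rewrite e addrC addKr eqxx.
Qed.

End Conv.

Lemma daddv_pi_add_id (F : numClosedFieldType) (V : vectType F) (X Y : {vspace V}) x y :
  (X :&: Y = 0)%VS -> x \in X -> y \in Y -> daddv_pi X Y (x + y) = x.
Proof.
move=> XY xX yY; rewrite linearD /= daddv_pi_id//.
have := daddv_pi_add XY (memv_add (mem0v X) yY).
rewrite add0r (daddv_pi_id _ yY); last by rewrite capvC.
by move=> /(canRL (addrK y)) ->; rewrite subrr addr0.
Qed.

Lemma sumv_seq_sub (F : numClosedFieldType) (V : vectType F) (I : eqType) (s : seq I)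
    (U : I -> {vspace V}) (X : {vspace V}) :
  (forall a, a \in s -> (U a <= X)%VS) -> (\sum_(a <- s) U a <= X)%VS.
Proof.
move=> UX; rewrite big_seq; elim/big_ind: _ => [|Y Z YX ZX|a /UX//]; first exact: sub0v.
by rewrite subv_add YX.
Qed.

Lemma sumv_seq_sup (F : numClosedFieldType) (V : vectType F) (I : eqType) (s : seq I)
    (U : I -> {vspace V}) a : a \in s -> (U a <= \sum_(a <- s) U a)%VS.
Proof. by move=> aS; rewrite (big_rem a aS) addvSl. Qed.

(** * Projections onto the components of a grading *)

Section GradingProjection.
Variables (F : numClosedFieldType) (n : nat) (m : 'I_n -> nat) (V : vectType F).
Variable gr : grG m -> {vspace V}.
Hypothesis grP : is_grading gr.

Lemma grading_ind (P : V -> Prop) : P 0 -> (forall a u v, P u -> P v -> P (a *: u + v)) ->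
  (forall a v, v \in gr a -> P v) -> forall v, P v.
Proof.
move=> P0 PD Pg v; have [Z ZP] := exists_vspace P0 PD; apply/ZP.
case: grP => [[s sE] _]; have : v \in fullv := memvf v; rewrite -sE.
apply: subvP v; apply: sumv_seq_sub => a _; apply/subvP => u ua.
by apply/ZP; exact: Pg ua.
Qed.

(** Directness for [a :: s] and for [s] gives the dimensions of both sums, and the dimension formula
    leaves 0 for the intersection. *)
Let grading_sum_cap (a : grG m) s : uniq (a :: s) -> (gr a :&: \sum_(b <- s) gr b = 0)%VS.
Proof.
case: grP => _ dir us; have := dir _ us; have /andP[_ /dir] := us.
rewrite !directvE /= !big_cons => /eqP e1 /eqP e2.
apply/eqP; rewrite -dimv_eq0 -(eqn_add2l (\dim (gr a + \sum_(b <- s) gr b))) addn0.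
by rewrite dimv_sum_cap e1 -e2.
Qed.

(** For [a] in the list, [P a] is the projection along the sum of the other components. A component
    outside the list meets the whole space, and so itself, in 0. *)
Lemma exists_grading_projection : exists (s : seq (grG m)) (P : grG m -> 'End(V)), [/\ uniq s,
  forall a v, P a v \in gr a, forall a v, v \in gr a -> P a v = v,
  forall a b v, a != b -> v \in gr b -> P a v = 0 & forall a v, v \in gr a -> a \notin s -> v = 0].
Proof.
case: grP => [[s sE] _].
(* Directness is available for lists without repetition only, and the spanning list may repeat
   classes. *)
pose S := undup s.
have SE : (\sum_(b <- S) gr b)%VS = fullv.
  apply/eqP; rewrite eqEsubv subvf -sE; apply: sumv_seq_sub => a aS.
  by apply: sumv_seq_sup; rewrite mem_undup.
have vanish a v : v \in gr a -> a \notin S -> v = 0.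
  move=> va aS; apply/eqP; rewrite -memv0 -(@grading_sum_cap a S) /= ?aS ?undup_uniq//.
  by rewrite memv_cap va SE memvf.
pose C a := (\sum_(b <- rem a S) gr b)%VS.
have aC a : (gr a :&: C a = 0)%VS.
  by apply: grading_sum_cap; rewrite /= rem_uniq ?undup_uniq// mem_rem_uniq ?undup_uniq// inE eqxx.
exists S, (fun a => daddv_pi (gr a) (C a)); split=> //.
- exact: undup_uniq.
- by move=> a v; exact: memv_pi.
- by move=> a v va; exact: daddv_pi_id.
move=> a b v ab vb; rewrite -[v]add0r; apply: (daddv_pi_add_id (aC a)); rewrite ?mem0v//.
have [bS|bS] := boolP (b \in S); last by rewrite (vanish b v vb bS) mem0v.
have bC : b \in rem a S by rewrite mem_rem_uniq ?undup_uniq// inE eq_sym ab.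
exact: subvP (sumv_seq_sup _ bC) _ vb.
Qed.

End GradingProjection.

(** * Homomorphisms between direct sums of irreducible modules *)

Section Components.
Variables (F : numClosedFieldType) (g : vectType F) (V W : vectType F).
Variables (act : g -> V -> V) (act' : g -> W -> W).
Hypothesis act'L : forall x, linear (act' x).

(** Schur's lemma: some summand is not killed by [Phi], and its image has a non-zero projection to
    some [U' q]. This projection is equivariant because the complementary sum [C q] is stable. *)
Lemma exists_iso_component (I J : finType) (U : I -> {vspace V}) (U' : J -> {vspace W})
    (Phi : 'Hom(V, W)) :
  (forall p, irreducible act fullv (U p)) -> (forall q, irreducible act' fullv (U' q)) ->
  (\sum_p U p)%VS = fullv -> (\sum_q U' q)%VS = fullv -> directv (\sum_q U' q) ->
  (forall x v, Phi (act x v) = act' x (Phi v)) -> (exists v, Phi v != 0) ->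
  exists p q, iso_on act (U p) act' (U' q).
Proof.
move=> irr irr' UE U'E dir PhiE [v0 Phi0].
have [p [u uU Phiu]] : exists p, exists2 u, u \in U p & Phi u != 0.
  apply: contrapT => np; case/eqP: Phi0.
  have : v0 \in fullv := memvf v0; rewrite -UE => /memv_sumP[vs vsU ->].
  rewrite linear_sum big1// => p _; apply: contrapT => /eqP e; apply: np.
  by exists p, (vs p) => //; exact: vsU.
pose C q := (\sum_(j | j != q) U' j)%VS.
have UC q : (U' q :&: C q = 0)%VS by have /directv_sumP/(_ q isT) := dir.
have act'S q x w : w \in C q -> act' x w \in C q.
  move=> /memv_sumP[ws wsU ->]; rewrite (lin_sum (act'L x)).
  apply: memv_sumr => j jq; case: (irr' j) => _ sj _.
  exact: sj (memvf x) (wsU j jq).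
pose pr q : 'End(W) := daddv_pi (U' q) (C q).
have dec q w : exists w1 w2, [/\ w1 \in U' q, w2 \in C q & w = w1 + w2].
  have : w \in fullv := memvf w; rewrite -U'E (bigD1 q)//= => /memv_addP[w1 w1U [w2 w2C ->]].
  by exists w1, w2.
have prE q x w : pr q (act' x w) = act' x (pr q w).
  have [w1 [w2 [w1U w2C ->]]] := dec q w.
  rewrite /pr (linD (act'L x)) !daddv_pi_add_id ?act'S//.
  by case: (irr' q) => _ sq _; exact: sq (memvf x) w1U.
have [q prq] : exists q, pr q (Phi u) != 0.
  apply: contrapT => nq; case/eqP: Phiu.
  have : Phi u \in fullv := memvf (Phi u); rewrite -U'E => /memv_sumP[ws wsU E].
  rewrite E big1// => q _; apply: contrapT => /eqP e; apply: nq; exists q.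
  rewrite E (bigD1 q)//= /pr daddv_pi_add_id//; first exact: wsU.
  by apply: memv_sumr => j _; exact: wsU.
exists p, q, (pr q \o Phi)%VF.
have phiE x v : (pr q \o Phi)%VF (act x v) = act' x ((pr q \o Phi)%VF v).
  by rewrite !comp_lfunE PhiE prE.
case: (irr p) => _ sp irrp; case: (irr' q) => _ sq irrq; split=> //.
- case: (irrq ((pr q \o Phi) @: U p)%VS).
  + by apply/subvP => _ /memv_imgP[w _ ->]; rewrite comp_lfunE memv_pi.
  + move=> x _ _ /memv_imgP[w wU ->]; rewrite -phiE memv_img//.
    exact: sp (memvf x) wU.
  + move=> e; case/negP: prq; rewrite -memv0 -e -comp_lfunE.
    exact: memv_img.
  + done.
- move=> w wU pw.
  case: (irrp (U p :&: lker (pr q \o Phi))%VS (capvSl _ _)) => [x v|e|e].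
  + move=> _; rewrite !memv_cap !memv_ker phiE => /andP[vU /eqP ->].
    by rewrite (lin0 (act'L x)) eqxx andbT; exact: sp (memvf x) vU.
  + by apply/eqP; rewrite -memv0 -e memv_cap wU memv_ker pw eqxx.
  + by case/negP: prq; move: uU; rewrite -e memv_cap memv_ker comp_lfunE => /andP[].
Qed.

End Components.

(** * Sums of irreducible modules over an orbit of weights *)

Section OrbitSum.
Variables (F : numClosedFieldType) (g : vectType F) (br : g -> g -> g).
Variables (form : g -> g -> F) (h : {vspace g}) (Pi : seq (dual h)).
Variables (n : nat) (sigma : 'I_n -> 'End(g)) (m : 'I_n -> nat) (xi : 'I_n -> F).
Hypotheses (g_lie : lie_algebra br) (h_cartan : cartan_subalgebra br fullv h).
Hypotheses (Pi_simple : simple_roots br fullv Pi) (form_inv : invariant_form br form).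
Hypothesis sigma_aut : commuting_automorphisms br sigma m.
Hypothesis xi_prim : forall i, (m i).-primitive_root (xi i).

(** The vectors [act x v] span [V]: in an irreducible summand the vectors satisfying [P] form a
    submodule, as it contains all these, and it is not 0 because [g] acts non-trivially on the
    summand when [lambda] is non-zero. *)
Lemma orbit_sum_act_ind (lambda : dual h) S (V : vectType F) (act : g -> V -> V) (P : V -> Prop) :
  lie_module br act -> orbit_sum br Pi sigma m xi act lambda S -> lambda != 0 ->
  P 0 -> (forall a u v, P u -> P v -> P (a *: u + v)) ->
  (forall l x v, x \in eig sigma xi l -> P (act x v)) -> forall v, P v.
Proof.
move=> actP [s [U [_ sE Uhw UE _]]] l0 P0 PD Pact v.
have [actr actl _] := actP.
have PA x u : P (act x u).
  apply: (eig_ind sigma_aut xi_prim (P := fun x => P (act x u))) x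
    => [x y Px Py|k x]; last exact: Pact.
  by rewrite (linD (actl u)) -[act x u]scale1r; exact: PD.
have [Z ZP] := exists_vspace P0 PD; apply/ZP.
have : v \in fullv := memvf v; rewrite -UE; apply: subvP v; apply/subv_sumP => -[i j] _.
have [[_ sU irrU] _] := Uhw i j.
case: (irrU (U (i, j) :&: Z)%VS (capvSl _ _)) => [x u _|Z0|<-]; last exact: capvSr.
  rewrite !memv_cap => /andP[uU _]; rewrite sU ?memvf//.
  exact/ZP.
case/eqP: l0.
apply: (char_orbit_trivial g_lie h_cartan Pi_simple form_inv sigma_aut xi_prim actP _ (Uhw i j)).
  by apply/sE; rewrite mem_nth.
move=> x u uU; apply/eqP; rewrite -memv0 -Z0 memv_cap sU ?memvf//.
exact/ZP.
Qed.

(** [Phi] yields an irreducible summand isomorphic to a summand of the other module, hence a common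
    twist of V(lambda) and V(lambda'). *)
Lemma char_orbit_common (lambda lambda' : dual h) S S' (V V' : vectType F)
    (act : g -> V -> V) (act' : g -> V' -> V') (Phi : 'Hom(V, V')) :
  lie_module br act -> lie_module br act' ->
  orbit_sum br Pi sigma m xi act lambda S -> orbit_sum br Pi sigma m xi act' lambda' S' ->
  (forall x v, Phi (act x v) = act' x (Phi v)) -> (exists v, Phi v != 0) ->
  char_orbit br Pi sigma m xi lambda lambda' /\ char_orbit br Pi sigma m xi lambda' lambda.
Proof.
move=> actP act'P [s [U [_ sE Uhw UE _]]] [s' [U' [_ s'E U'hw U'E dir']]] PhiE Phi0.
have irr p : irreducible act fullv (U p) by case: p => i j; case: (Uhw i j).
have irr' p : irreducible act' fullv (U' p) by case: p => i j; case: (U'hw i j).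
have act'L x : linear (act' x) by case: act'P.
have [[i j] [[i' j'] iso]] := exists_iso_component act'L irr irr' UE U'E dir' PhiE Phi0.
have o : char_orbit br Pi sigma m xi lambda s`_i by apply/sE; rewrite mem_nth.
have o' : char_orbit br Pi sigma m xi lambda' s'`_i' by apply/s'E; rewrite mem_nth.
split.
  apply: (char_orbit_iso g_lie h_cartan Pi_simple form_inv sigma_aut xi_prim act'P actP
    o' (U'hw i' j') o (Uhw i j)).
  by apply: iso_on_sym iso; case: (irr (i, j)).
exact: (char_orbit_iso g_lie h_cartan Pi_simple form_inv sigma_aut xi_prim actP act'P
    o (Uhw i j) o' (U'hw i' j') iso).
Qed.

End OrbitSum.

(** * Action of homogeneous elements on homogeneous vectors *)

Section Action.
Variables (F : numClosedFieldType) (g : vectType F) (br : g -> g -> g).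
Variables (n : nat) (sigma : 'I_n -> 'End(g)) (m : 'I_n -> nat) (xi : 'I_n -> F).
Variables (V1 V2 : vectType F) (act1 : 'M[F]_n -> V1 -> V1) (act2 : g -> V2 -> V2).
Variables (gr : grG m -> {vspace V2}) (beta : 'rV[F]_n).
Hypotheses (act1P : lie_module (@gl_br F n) act1) (act2P : graded_module br sigma xi act2 gr).
Local Notation Zn := 'rV[int]_n.

Definition tauL (l : Zn) (x : g) : tau sigma m xi := (mono (eig sigma xi) l x, 0, 0).
Definition tauD (r : Zn) (u : 'rV[F]_n) : tau sigma m xi := (0, 0, mono (GammaU F m) r u).

Definition vmono (k : Zn) (w : tens V1 V2) : Vmod V1 gr :=
  mono (fun k => tens_sub {:V1} (gr (bar m k))) k w.

Let act1r A : linear (act1 A). Proof. by case: act1P. Qed.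
Let act2r x : linear (act2 x). Proof. by case: act2P => -[]. Qed.
Let act2l v : linear (act2^~ v). Proof. by case: act2P => -[]. Qed.
Let idL (V : vectType F) : linear (@id V). Proof. by []. Qed.

Let T (k : Zn) := tens_sub {:V1} (gr (bar m k)).

Let actL_mem l x k w : x \in eig sigma xi l -> w \in T k ->
  tens_map id (act2 x) w \in T (l + k).
Proof.
move=> xl; apply: tens_map_sub => // u uk; rewrite barD.
by case: act2P => _ _ h; exact: h.
Qed.

Let actL0 (l k : Zn) w : actL (V1 := V1) act2 l 0 k w = 0.
Proof.
rewrite /actL /tens_map big1// => i _; rewrite big1// => j _.
by rewrite (lin0 (act2l _)) (lin0 (pure_linr _)) scaler0.
Qed.

Let actD0 (l k : Zn) w : actD (V2 := V2) act1 beta l 0 k w = 0.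
Proof. by rewrite /actD big1// => i _; rewrite mxE scale0r. Qed.

Let actD0r (r : Zn) u (k : Zn) : actD (V2 := V2) act1 beta r u k 0 = 0.
Proof.
rewrite /actD big1// => i _; rewrite scaler0 add0r big1 ?scaler0// => j _.
by rewrite (lin0 (tens_map_lin _ _)) scaler0.
Qed.

Let actD_mem r u k w : r \in Gamma m -> w \in T k ->
  actD act1 beta r u k w \in T (r + k).
Proof.
move=> rG wT; rewrite /T [r + k]addrC bar_Gamma//.
rewrite /actD; apply: memv_suml => i _; rewrite memvZ// memvD ?memvZ//.
apply: memv_suml => j _; rewrite memvZ//; apply: tens_map_sub wT => // u' _.
exact: memvf.
Qed.

Lemma Vact_tauL l x f j : x \in eig sigma xi l ->
  Vact act1 act2 (gr := gr) beta (tauL l x) f j = tens_map id (act2 x) (f (j - l)).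
Proof.
move=> xl; rewrite /Vact /tauL conv0l ?addr0//.
rewrite conv_mono// => [k|k w]; first exact: (lin0 (tens_map_lin _ _)).
exact: actL_mem.
Qed.

Lemma Vact_tauD r u f j : r \in Gamma m ->
  Vact act1 act2 (gr := gr) beta (tauD r u) f j = actD act1 beta r u (j - r) (f (j - r)).
Proof.
move=> rG; rewrite /Vact /tauD conv0l ?add0r//.
rewrite conv_mono// => [|k w]; last exact: actD_mem.
by rewrite /GammaU rG memvf.
Qed.

Lemma actD_delta (r : Zn) i (k : Zn) (w : tens V1 V2) : actD act1 beta r (delta_mx 0 i) k w =
  (zc F k i + beta 0 i) *: w + \sum_j zc F r j *: tens_map (act1 (delta_mx j i)) id w.
Proof.
rewrite /actD (bigD1 i)//= mxE !eqxx scale1r [X in _ + X]big1 ?addr0// => j /negPf ji.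
by rewrite mxE ji andbF scale0r.
Qed.

Lemma vmonoE k w j : w \in T k -> vmono k w j = if j == k then w else 0.
Proof. exact: monoE. Qed.

Lemma Vact_tauL_vmono l x k w : x \in eig sigma xi l -> w \in T k ->
  Vact act1 act2 (gr := gr) beta (tauL l x) (vmono k w) = vmono (l + k) (tens_map id (act2 x) w).
Proof.
move=> xl wT; apply: gsumP => j; rewrite Vact_tauL// !vmonoE ?actL_mem//.
rewrite [l + k]addrC subr_eq; case: eqP => // _; exact: (lin0 (tens_map_lin _ _)).
Qed.

Lemma Vact_tauD_vmono r u k w : r \in Gamma m -> w \in T k ->
  Vact act1 act2 (gr := gr) beta (tauD r u) (vmono k w) = vmono (r + k) (actD act1 beta r u k w).
Proof.
move=> rG wT; apply: gsumP => j; rewrite Vact_tauD// !vmonoE ?actD_mem//.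
by rewrite [r + k]addrC subr_eq; case: eqP => [->|_]; rewrite ?addrK.
Qed.

Lemma vmono_lin k a w w' : w \in T k -> w' \in T k ->
  vmono k (a *: w + w') = a *: vmono k w + vmono k w'.
Proof.
move=> wT w'T; apply: gsumP => j; rewrite vmonoE ?memvD ?memvZ//.
rewrite -[RHS]/(a *: vmono k w j + vmono k w' j) !vmonoE//.
by case: eqP => // _; rewrite scaler0 addr0.
Qed.

Lemma vmonoZ k a w : w \in T k -> vmono k (a *: w) = a *: vmono k w.
Proof.
by move=> wT; rewrite -[LHS]/(vmono k _) -[_ *: w]addr0 vmono_lin ?mem0v// [X in _ + X]mono0 addr0.
Qed.

End Action.

(** * Components of an isomorphism *)

Section Isomorphism.
Variables (F : numClosedFieldType) (g : vectType F) (br : g -> g -> g).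
Variables (n : nat) (sigma : 'I_n -> 'End(g)) (m : 'I_n -> nat) (xi : 'I_n -> F).
Hypotheses (g_lie : lie_algebra br) (sigma_aut : commuting_automorphisms br sigma m).
Hypothesis xi_prim : forall i, (m i).-primitive_root (xi i).
Variables (V1 V2 V1' V2' : vectType F).
Variables (act1 : 'M[F]_n -> V1 -> V1) (act1' : 'M[F]_n -> V1' -> V1').
Variables (act2 : g -> V2 -> V2) (act2' : g -> V2' -> V2').
Variables (gr : grG m -> {vspace V2}) (gr' : grG m -> {vspace V2'}).
Variables (beta beta' : 'rV[F]_n).
Hypotheses (act1P : lie_module (@gl_br F n) act1) (act2P : graded_module br sigma xi act2 gr).
Hypotheses (act1'P : lie_module (@gl_br F n) act1') (act2'P : graded_module br sigma xi act2' gr').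
Variable f : {linear Vmod V1 gr -> Vmod V1' gr'}.
Hypothesis f_inj : injective f.
Hypothesis f_act : forall (X : tau sigma m xi) v,
  f (Vact act1 act2 beta X v) = Vact act1' act2' beta' X (f v).
Local Notation Zn := 'rV[int]_n.
Local Notation tauD := (@tauD F g n sigma m xi).
Local Notation tauL := (@tauL F g n sigma m xi).
Local Notation vmono := (@vmono F n m V1 V2 gr).

Let T (k : Zn) := tens_sub {:V1} (gr (bar m k)).

Let act1L A : linear (act1 A). Proof. by case: act1P. Qed.
Let act2L x : linear (act2 x). Proof. by case: act2P => -[]. Qed.
Let act1'L A : linear (act1' A). Proof. by case: act1'P. Qed.
Let act2'L x : linear (act2' x). Proof. by case: act2'P => -[]. Qed.
Let idL (V : vectType F) : linear (@id V). Proof. by []. Qed.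

(** Compare the two actions of the degree derivation [t^0 d_i] in degree [j] of the image: both are
    scalar. *)
Lemma image_homogeneous k w j : w \in T k -> f (vmono k w) j != 0 ->
  forall i, zc F k i + beta 0 i = zc F j i + beta' 0 i.
Proof.
move=> wT fj i; have G0 : 0 \in Gamma m by exact: rpred0.
have := congr1 (fun v : Vmod V1' gr' => v j) (f_act (tauD 0 (delta_mx 0 i)) (vmono k w)).
rewrite (Vact_tauD_vmono _ act1P act2P)// (Vact_tauD _ act1'P act2'P)// !actD_delta add0r subr0.
have zc0 l : zc F (0 : Zn) l = 0 by rewrite /zc mxE.
rewrite !big1; try by move=> l _; rewrite zc0 scale0r.
rewrite !addr0 vmonoZ// linearZ => e.
have {}e : (zc F k i + beta 0 i) *: f (vmono k w) j =
    (zc F j i + beta' 0 i) *: f (vmono k w) j by [].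
apply/eqP; rewrite -subr_eq0; move/eqP: e; rewrite -subr_eq0 -scalerBl scaler_eq0.
by rewrite (negPf fj) orbF.
Qed.

Section Shifted.
Variable s : Zn.
Hypothesis sE : forall i, beta 0 i = zc F s i + beta' 0 i.

Definition component k w : tens V1' V2' := f (vmono k w) (k + s).

(** By [image_homogeneous] the image of [vmono k w] lives in degree [k + s] only, so it is
    determined by this component, and [f] is injective. *)
Lemma component_neq0 k w : w \in T k -> w != 0 -> component k w != 0.
Proof.
move=> wT w0; apply: contra w0 => /eqP c0.
suff /f_inj e : f (vmono k w) = f 0.
  by have := congr1 (fun v : Vmod V1 gr => v k) e; rewrite vmonoE// eqxx => ->.
rewrite linear0; apply: gsumP => j; apply: contrapT => /eqP fj; case/eqP: (fj).
rewrite -[RHS]c0 /component; congr (f _ _).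
apply/rowP => i; rewrite mxE; have := image_homogeneous wT fj i.
rewrite sE addrA => /addIr /esym; rewrite /zc -intrD => /intr_inj.
exact.
Qed.

Lemma component_lin k a w w' : w \in T k -> w' \in T k ->
  component k (a *: w + w') = a *: component k w + component k w'.
Proof. by move=> wT w'T; rewrite /component vmono_lin// linearP. Qed.

Lemma componentZ k a w : w \in T k -> component k (a *: w) = a *: component k w.
Proof. by move=> wT; rewrite /component vmonoZ// linearZ. Qed.

Lemma component_actL l x k w : x \in eig sigma xi l -> w \in T k ->
  component (l + k) (tens_map id (act2 x) w) = tens_map id (act2' x) (component k w).
Proof.
move=> xl wT; rewrite /component -(Vact_tauL_vmono act1 beta act2P xl wT) f_act.
by rewrite (Vact_tauL _ _ act2'P)// -[l + k + s]addrA [l + _]addrC addrK.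
Qed.

(** In degree [k + s] of the target the derivation has the scalar [(k + s)_i + beta'_i], which is
    [k_i + beta_i] by [sE]. Having the same scalar on both sides allows it to be cancelled in
    [hom_at_gl]. *)
Lemma component_actD r i k w : r \in Gamma m -> w \in T k ->
  component (r + k)
    ((zc F k i + beta 0 i) *: w + \sum_j zc F r j *: tens_map (act1 (delta_mx j i)) id w) =
  (zc F k i + beta 0 i) *: component k w +
  \sum_j zc F r j *: tens_map (act1' (delta_mx j i)) id (component k w).
Proof.
move=> rG wT; rewrite -actD_delta /component -(Vact_tauD_vmono _ act1P act2P)// f_act.
rewrite (Vact_tauD _ act1'P act2'P)// -[r + k + s]addrA [r + _]addrC addrK actD_delta.
by congr (_ *: _ + _); rewrite sE addrA /zc mxE intrD.
Qed.

Section Projected.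
Variable P : grG m -> 'End(V2).
Hypotheses (P_mem : forall a v, P a v \in gr a) (P_id : forall a v, v \in gr a -> P a v = v).
Hypothesis P_neq : forall a b v, a != b -> v \in gr b -> P a v = 0.

(** The projection [P] extends the component in degree [k] to a bilinear map on all of [V1] and
    [V2], so that different degrees can be compared. *)
Definition hom_at k v1 v2 := component k (pure v1 (P (bar m k) v2)).

Let pureT k v1 v2 : pure v1 (P (bar m k) v2) \in T k.
Proof. by apply: mem_pure; rewrite ?memvf. Qed.

Lemma hom_at_linr k v1 : linear (hom_at k v1).
Proof.
by move=> a u v; rewrite /hom_at linearP (pure_linr v1) component_lin ?pureT.
Qed.

Lemma hom_at_linl k v2 : linear ((hom_at k)^~ v2).
Proof.
by move=> a u v; rewrite /hom_at (pure_linl _) component_lin ?pureT.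
Qed.

(** On homogeneous [v] either both projections are the identity or both give 0, since [x] shifts
    classes by [bar m l]. *)
Lemma projection_act l x k v : x \in eig sigma xi l ->
  P (bar m (l + k)) (act2 x v) = act2 x (P (bar m k) v).
Proof.
move=> xl; have [_ grP actgr] := act2P.
have h b u : u \in gr b -> act2 x u \in gr (bar m l + b).
  by have [k' <-] := bar_repr b; exact: actgr.
apply: (grading_ind grP (P := fun v => P (bar m (l + k)) (act2 x v) = act2 x (P (bar m k) v))) v.
- by rewrite (lin0 (act2L x)) !linear0 (lin0 (act2L x)).
- by move=> a u v e e'; rewrite (act2L x) !linearP /= e e' (act2L x).
move=> b v vb; rewrite barD; have [bE|kb] := eqVneq b (bar m k).
  by rewrite P_id ?P_id// -?bE//; exact: h.
rewrite (P_neq _ vb) 1?eq_sym// (lin0 (act2L x)) (P_neq _ (h _ _ vb))//.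
by rewrite (inj_eq (addrI _)) eq_sym.
Qed.

Lemma hom_at_act l x k v1 v2 : x \in eig sigma xi l ->
  hom_at (l + k) v1 (act2 x v2) = tens_map id (act2' x) (hom_at k v1 v2).
Proof.
move=> xl; rewrite /hom_at projection_act//.
by have := component_actL xl (pureT k v1 v2); rewrite tens_map_pure// => <-.
Qed.

Hypothesis act2_ind : forall P : V2 -> Prop,
  P 0 -> (forall a u v, P u -> P v -> P (a *: u + v)) ->
  (forall l x v, x \in eig sigma xi l -> P (act2 x v)) -> forall v, P v.

(* As V2 is spanned by the elements x v, the degree can be moved within its class modulo Gamma
   by changing the degree of x. *)
Lemma hom_at_Gamma r k v1 v2 : r \in Gamma m -> hom_at (r + k) v1 v2 = hom_at k v1 v2.
Proof.
move=> rG; apply: (act2_ind (P := fun v2 => hom_at (r + k) v1 v2 = hom_at k v1 v2)) v2.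
- by rewrite !(lin0 (hom_at_linr _ _)).
- by move=> a u v e e'; rewrite !hom_at_linr e e'.
move=> l x v xl; have xl' : x \in eig sigma xi (l + r) by rewrite (eig_Gamma _ xi_prim).
have -> : r + k = (l + r) + (k - l) by rewrite [l + r]addrC -addrA [l + _]addrC subrK.
by rewrite hom_at_act//; have := hom_at_act (k - l) v1 v xl; rewrite [l + _]addrC subrK => ->.
Qed.

(** Apply [t^r d_i] where the only non-zero entry of [r] is [m j], in place [j]. By [hom_at_Gamma]
    the scalar terms on both sides agree and cancel, leaving [m j] times the action of the matrix
    unit. *)
Lemma hom_at_gl j i k v1 v2 : hom_at k (act1 (delta_mx j i) v1) v2 =
  tens_map (act1' (delta_mx j i)) id (hom_at k v1 v2).
Proof.
pose r : Zn := \row_i (if i == j then (m j)%:Z else 0).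
have rG : r \in Gamma m.
  by apply/forallP => i'; rewrite mxE; case: eqP => [->|_]; rewrite ?dvdz0.
have rj (W : lmodType F) (G : 'I_n -> W) : \sum_j' zc F r j' *: G j' = (m j)%:R *: G j.
  rewrite (bigD1 j)//= /zc mxE eqxx big1 ?addr0// => j' /negPf jj'.
  by rewrite mxE jj' scale0r.
have mj0 : (m j)%:R != 0 :> F by rewrite pnatr_eq0 -lt0n (prim_order_gt0 (xi_prim j)).
have wT v : pure v (P (bar m k) v2) \in T (r + k).
  by rewrite /T addrC bar_Gamma//; exact: pureT.
have cE v : component (r + k) (pure v (P (bar m k) v2)) = hom_at k v v2.
  by rewrite -(hom_at_Gamma k v v2 rG) /hom_at [in bar m (r + k)]addrC bar_Gamma.
have := component_actD i rG (pureT k v1 v2).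
rewrite !rj tens_map_pure// component_lin ?memvZ// componentZ// !cE => /addrI.
exact: scalerI.
Qed.

Variables (S : seq (grG m)) (rep : grG m -> Zn).
Hypotheses (S_uniq : uniq S) (repK : forall a, bar m (rep a) = a).
Hypothesis gr_notin : forall a v, v \in gr a -> a \notin S -> v = 0.

(** The components glued into one bilinear map, with one representative for each class in the list
    [S], outside which the graded pieces are 0. *)
Definition total_hom v1 v2 := \sum_(a <- S) hom_at (rep a) v1 v2.

Lemma total_hom_lin v1 : linear (total_hom v1).
Proof.
move=> a u v; rewrite /total_hom scaler_sumr -big_split; apply: eq_bigr => b _ /=.
exact: hom_at_linr.
Qed.

(** The terms of the other classes vanish as their projections kill [v2]; in the remaining term the
    representative differs from [k] by an element of [Gamma]. *)
Lemma total_hom_at k v1 v2 : v2 \in gr (bar m k) -> total_hom v1 v2 = hom_at k v1 v2.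
Proof.
move=> v2k; have [kS|kS] := boolP (bar m k \in S); last first.
  by rewrite (gr_notin v2k kS) (lin0 (total_hom_lin v1)) (lin0 (hom_at_linr k v1)).
rewrite /total_hom (bigD1_seq _ kS S_uniq)/= big1 ?addr0 => [|a ak].
  rewrite -[rep _](subrK k) hom_at_Gamma//.
  by apply: bar_eq; rewrite repK.
rewrite /hom_at repK (P_neq ak v2k) (lin0 (pure_linr v1)).
by rewrite -[X in component _ X](scale0r (0 : tens V1 V2)) componentZ ?mem0v// scale0r.
Qed.

(** By linearity [x] and [v] may be taken homogeneous, and then [hom_at_act] applies. Slicing makes
    this a homomorphism of [g]-modules from [V2] to [V2']. *)
Lemma total_hom_act i v1 x v :
  row_slice i (total_hom v1 (act2 x v)) =
  act2' x (row_slice i (total_hom v1 v)).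
Proof.
have [[_ act2l _] grP actgr] := act2P; have [[_ act2'l _] _ _] := act2'P.
pose Th v := row_slice i (total_hom v1 v).
have ThL : linear Th by move=> a u w; rewrite /Th total_hom_lin row_slice_lin.
apply: (eig_ind sigma_aut xi_prim (P := fun x => Th (act2 x v) = act2' x (Th v))) x.
  by move=> x y ex ey; rewrite (linD (act2l v)) (linD ThL) ex ey (linD (act2'l _)).
move=> l x xl.
apply: (grading_ind grP (P := fun v => Th (act2 x v) = act2' x (Th v))) v.
- by rewrite (lin0 (act2L x)) (lin0 ThL) (lin0 (act2'L x)).
- by move=> a u w eu ew; rewrite (act2L x) !ThL eu ew (act2'L x).
move=> a v; have [k <-] := bar_repr a => vk.
rewrite /Th (total_hom_at _ vk) (total_hom_at (k := l + k)); last first.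
  by rewrite barD; exact: actgr.
by rewrite hom_at_act// row_slice_map.
Qed.

End Projected.
End Shifted.
End Isomorphism.

(** * Comparison of the parameters of two isomorphic modules *)

Theorem theorem8p2 (R : realType)
  (* the simple Lie algebra g, its Cartan subalgebra, simple roots and form *)
  (g : vectType R[i]) (br : g -> g -> g) (form : g -> g -> R[i])
  (h : {vspace g}) (Pi : seq (dual h))
  (g_lie : lie_algebra br) (g_simple : simple_lie br fullv)
  (h_cartan : cartan_subalgebra br fullv h)
  (Pi_simple : simple_roots br fullv Pi)
  (form_inv : invariant_form br form)
  (* the Lie torus LT *)
  (n : nat) (sigma : 'I_n -> 'End(g)) (m : 'I_n -> nat) (xi : 'I_n -> R[i])
  (sigma_aut : commuting_automorphisms br sigma m)
  (xi_prim : forall i, (m i).-primitive_root (xi i))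
  (h0 : {vspace g}) (h0h : (h0 <= h)%VS) (LT_torus : lie_torus br sigma m xi h0)
  (* phi = a1 phi_1 + a2 phi_2 *)
  (a1 a2 : R[i])
  (psi psi' : dual (sl_cartan R[i] n)) (c c' : R[i])
  (lambda lambda' : dual h) (beta beta' : 'rV[R[i]]_n)
  (psi_dom : sl_dominant_integral psi) (psi'_dom : sl_dominant_integral psi')
  (lambda_dom : dominant_integral br fullv Pi lambda) (lambda_neq0 : lambda != 0)
  (lambda'_dom : dominant_integral br fullv Pi lambda') (lambda'_neq0 : lambda' != 0)
  (* any realisations of V(psi, c, lambda, beta) and V(psi', c', lambda', beta') *)
  (V1 V2 V1' V2' : vectType R[i])
  (act1 : 'M[R[i]]_n -> V1 -> V1) (act1' : 'M[R[i]]_n -> V1' -> V1')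
  (act2 : g -> V2 -> V2) (act2' : g -> V2' -> V2')
  (gr : grG m -> {vspace V2}) (gr' : grG m -> {vspace V2'})
  (V1P : is_V_gl c psi act1) (V1'P : is_V_gl c' psi' act1')
  (V2P : is_V2 br Pi sigma xi lambda act2 gr)
  (V2'P : is_V2 br Pi sigma xi lambda' act2' gr') :
  isomorphic_modules (tau_br br form a1 a2 (sigma := sigma) (m := m) (xi := xi))
    (Vact act1 act2 (gr := gr) beta) (Vact act1' act2' (gr := gr') beta') ->
  [/\ psi = psi' /\ c = c',
      [/\ char_orbit br Pi sigma m xi lambda lambda',
          char_orbit br Pi sigma m xi lambda = char_orbit br Pi sigma m xi lambda'
        & schur_index br Pi sigma m xi lambda = schur_index br Pi sigma m xi lambda']
    & exists k : 'rV[int]_n, beta - beta' = map_mx intr k].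
Proof.
move=> [_ _ [f [f_bij f_act]]].
have f_inj : injective f := bij_inj f_bij.
have [act1P irr1 act1c [v1 [v1_0 v1w v1p]]] := V1P.
have [act1'P irr1' act1'c [v1' [v1'_0 v1'w v1'p]]] := V1'P.
have [osum [gm V2_0 _]] := V2P; have [osum' [gm' _ _]] := V2'P.
have [act2P grP _] := gm; have [act2'P _ _] := gm'.
have [S [P [S_uniq P_mem P_id P_neq gr_notin]]] := exists_grading_projection grP.
have [k0 [v2 v2k v2_0]] : exists k0, exists2 v2, v2 \in gr (bar m k0) & v2 != 0.
  apply: contrapT => nk; case/eqP: V2_0; apply/vspaceP => v; rewrite memvf memv0; apply/esym/eqP.
  apply: (grading_ind grP (P := fun v => v = 0)) v => [//|a u w -> ->|a v va].
    by rewrite scaler0 addr0.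
  have [k kE] := bar_repr a; apply: contrapT => /eqP v0; apply: nk.
  by exists k, v => //; rewrite kE.
have w0T : pure v1 v2 \in tens_sub fullv (gr (bar m k0)) by apply: mem_pure; rewrite ?memvf.
have [j0 fj0] : exists j0, f (vmono gr k0 (pure v1 v2)) j0 != 0.
  apply: contrapT => nj; case/eqP: (pure_neq0 v1_0 v2_0).
  suff /f_inj e : f (vmono gr k0 (pure v1 v2)) = f 0.
    by have := congr1 (fun v : Vmod V1 gr => v k0) e; rewrite vmonoE// eqxx => ->.
  rewrite linear0; apply: gsumP => j; apply: contrapT => /eqP fj; apply: nj.
  by exists j.
(* The shift is read off from a single homogeneous vector and one degree [j0] in which its image is
   non-zero; the degree derivations then give [beta - beta' = s]. *)
pose s := j0 - k0.
have sE i : beta 0 i = zc R[i] s i + beta' 0 i.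
  have := image_homogeneous act1P gm act1'P gm' f_act w0T fj0 i.
  rewrite /zc !mxE rmorphB /= => e; apply: (addrI ((k0 0 i)%:~R)).
  by rewrite e [in RHS]addrA [_ + (_ - _)]addrC subrK.
have act2_ind := orbit_sum_act_ind g_lie h_cartan Pi_simple form_inv sigma_aut xi_prim
  act2P osum lambda_neq0.
pose M := hom_at f s P.
have M0 : M k0 v1 v2 != 0.
  rewrite /M /hom_at P_id//.
  exact: (component_neq0 act1P gm act1'P gm' f_inj f_act sE w0T (pure_neq0 v1_0 v2_0)).
split.
(* Fixing [v2] and contracting the second factor of the target gives a homomorphism [eta] of
   gl_n-modules that is non-zero at [v1]. Hence [eta v1] is a highest weight vector of [V1'] of
   weight [psi]. *)
- have [j eta0] := exists_col_slice M0.
  pose eta v := col_slice j (M k0 v v2).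
  have etaL : linear eta.
    by move=> a u v; rewrite /eta /M (hom_at_linl f s P_mem) col_slice_lin.
  have [act1L act1l _] := act1P; have [act1'L act1'l _] := act1'P.
  have etaE A v : eta (act1 A v) = act1' A (eta v).
    rewrite [A]matrix_sum_delta (lin_sum (act1l v)) (lin_sum (act1'l _)) (lin_sum etaL).
    apply: eq_bigr => p _; rewrite (lin_sum (act1l v)) (lin_sum (act1'l _)) (lin_sum etaL).
    apply: eq_bigr => q _; rewrite (linZ (act1l v)) (linZ (act1'l _)) (linZ etaL).
    by rewrite /eta /M (hom_at_gl xi_prim act1P gm act1'P gm' f_act sE
      P_mem P_id P_neq act2_ind) col_slice_map.
  split.
    apply: (gl_highest_weight_unique act1'P act1'c irr1' eta0 _ _ v1'_0 v1'w v1'p).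
      by move=> y; rewrite -/(eta v1) -etaE v1w (linZ etaL).
    by move=> p q pq; rewrite -/(eta v1) -etaE v1p// (lin0 etaL).
  (* The identity matrix acts on [eta v1] both by [c] and by [c']. *)
  have : (c - c') *: eta v1 = 0.
    by rewrite scalerBl -(linZ etaL) -act1c etaE act1'c subrr.
  by move/eqP; rewrite scaler_eq0 (negPf eta0) orbF subr_eq0 => /eqP.
(* Fixing [v1] and contracting the first factor of the target gives a homomorphism of [g]-modules
   from [V2] to [V2'], non-zero at [v2], where the glued map agrees with the component in degree
   [k0]. *)
- have [rep repK] := choice (bar_repr (m := m)).
  have [i Th0] := exists_row_slice M0.
  pose Th v := row_slice i (total_hom f s P S rep v1 v).
  have ThL : linear Th.
    by move=> a u v; rewrite /Th (total_hom_lin f s P_mem) row_slice_lin.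
  have PhiE x v : linfun Th (act2 x v) = act2' x (linfun Th v).
    rewrite !(linear_lfunE ThL).
    exact: (total_hom_act sigma_aut xi_prim gm gm' f_act s P_mem
      P_id P_neq act2_ind S_uniq repK gr_notin).
  have Phi0 : exists v, linfun Th v != 0.
    exists v2; rewrite (linear_lfunE ThL) /Th.
    by rewrite (total_hom_at xi_prim gm gm' f_act s P_mem
      P_id P_neq act2_ind S_uniq repK gr_notin v1 v2k).
  have [o o'] := char_orbit_common g_lie h_cartan Pi_simple form_inv sigma_aut xi_prim
    act2P act2'P osum osum' PhiE Phi0.
  have e : char_orbit br Pi sigma m xi lambda = char_orbit br Pi sigma m xi lambda'.
    apply/funext => mu; apply/propext; split.
      exact: (char_orbit_trans g_lie h_cartan Pi_simple form_inv sigma_aut xi_prim o').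
    exact: (char_orbit_trans g_lie h_cartan Pi_simple form_inv sigma_aut xi_prim o).
  by split=> //; exact: schur_index_orbit.
- exists s; apply/rowP => i; rewrite !mxE sE addrK.
  by rewrite /zc !mxE.
Qed.
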